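(* Let $\mu$ be a quasi-Bernoulli independent random measure on $\mathbb{A}$, and assume that $\tau_\mu$ is twice continuously differentiable. Let $J=\{q\in\mathbb{R}:\tau_\mu'(q)q-\tau_\mu(q)>0\}$. Let $(\varepsilon_n)_{n\ge1}$ be a sequence of positive numbers going to $0$ such that for all $M,a>0$ the series $\sum_{n\ge1}b^{Mn^{3/4}\log(n)}b^{-na\varepsilon_n^2}$ converges, and such that $\varepsilon_n\ge n^{-1/8}\log(n)^{1/2+\eta}$ for all $n$, for some $\eta>0$. Let $K$ be a compact subinterval of $J$, and let $\beta=1+\max_{q\in K}|q|$. For every $\alpha>1$, with probability one, for $j$ large enough, for all $q\in K$ and for all $n\ge\big[\exp\big(\sqrt{\alpha\log(j)}\big)\big]$, one has $$b^{n(\tau_\mu'(q)q-\tau_\mu(q)-\beta\varepsilon_n)}\le\mathcal{N}_n\big(\mu^{(j)},\tau_\mu'(q),\varepsilon_n\big)\le b^{n(\tau_\mu'(q)q-\tau_\mu(q)+\beta\varepsilon_n)}.$$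
   Context: **Symbolic space.** $b\ge 2$ is an integer, $\mathcal{A}=\{0,\dots,b-1\}$, $\mathcal{A}^*=\bigcup_{n\ge1}\mathcal{A}^n$, and $\mathbb{A}=\mathcal{A}^{\{1,2,3,\dots\}}$ with the product topology. For a finite word $w$ of length $n$, $[w]\subset\mathbb{A}$ is the cylinder of sequences whose first $n$ letters form $w$. For a real number $x$, $[x]$ is its integer part. All random variables are defined on a probability space $(\Omega,\mathcal{B},\mathbb{P})$. **Quasi-Bernoulli independent random measure.** A random probability measure $\mu=\mu(\omega)$ on $\mathbb{A}$ is a quasi-Bernoulli independent random measure if there exist a constant $C>0$ and two sequences of random measures $(\mu_j)_{j\ge1}$ and $(\mu^{(j)})_{j\ge1}$ on $\mathbb{A}$ such that for every $j\ge1$: (P1) for all $(v,w)\in\mathcal{A}^j\times\mathcal{A}^*$, $\frac1C\mu_j([v])\mu^{(j)}([w])\le\mu([vw])\le C\mu_j([v])\mu^{(j)}([w])$; (P2) for every $r\in\{0,\dots,b-1\}$, $0<\operatorname{ess\,inf}\mu([r])\le\operatorname{ess\,sup}\mu([r])<\infty$; (P3) $(\mu^{(j)}([w]))_{w\in\mathcal{A}^*}$ and $(\mu([w]))_{w\in\mathcal{A}^*}$ have the same distribution; $\mu$ is also denoted $\mu^{(0)}$; (P4) the $\sigma$-algebras $\sigma(\mu_j([v]):v\in\mathcal{A}^j)$ and $\sigma(\mu^{(j)}([w]):w\in\mathcal{A}^* )$ are independent. The measures $\mu^{(j)}$ in the claim are these copies of $\mu$. **The function $\tau_\mu$.** $\tau_\mu(q)=\liminf_{j\to\infty}-\frac1j\log_b\sum_{w\in\mathcal{A}^j}\mu([w])^q$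 for $q\in\mathbb{R}$. With probability one this is a limit for all $q\in\mathbb{R}$, and $\tau_\mu$ is a deterministic real-valued function of $q$. **Counting function.** For integers $j,n\ge1$, a real number $a$ and $\varepsilon>0$, $$\mathcal{N}_n(\mu^{(j)},a,\varepsilon)=\#\big\{w\in\mathcal{A}^n:\ b^{-n(a+\varepsilon)}\le\mu^{(j)}([w])\le b^{-n(a-\varepsilon)}\big\}.$$ *)

(* Defs.v *)
From HB Require Import structures.
From mathcomp Require Import all_boot all_order all_algebra.
From mathcomp Require Import all_classical all_reals all_analysis.
From mathcomp Require Import measurable_realfun ess_sup_inf.

Set Implicit Arguments.
Unset Strict Implicit.
Unset Printing Implicit Defensive.

Import Order.TTheory GRing.Theory Num.Theory.
Import numFieldNormedType.Exports.

Local Open Scope classical_set_scope.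
Local Open Scope ring_scope.

(* The argument hb only serves to make the alphabet 'I_b a pointed type, which
   the library requires of measurable types. *)
Definition letter (b : nat) (hb : (2 <= b)%N) : Type := 'I_b.

HB.instance Definition _ b (hb : (2 <= b)%N) := Finite.on (letter hb).
HB.instance Definition _ b (hb : (2 <= b)%N) :=
  isPointed.Build (letter hb) (Ordinal (ltnW hb) : 'I_b).

(* Sequences with the Borel sigma-algebra of the product topology; position
   i : nat holds the letter of index i.+1. *)
Notation symb hb := (g_sigma_algebraType
  (@open (prod_topology (fun _ : nat => discrete_topology (letter hb))))).

Definition cylinder b (hb : (2 <= b)%N) (w : seq (letter hb)) :
    set (symb hb) :=
  [set x : nat -> letter hb | mkseq x (size w) = w].

Definition word b (hb : (2 <= b)%N) : Type :=
  {w : seq (letter hb) | w != [::]}.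

Section families.
Context {R : realType}.

Definition sigma_of (T I : Type) (X : I -> T -> \bar R) : set (set T) :=
  <<s \bigcup_i preimage_set_system setT (X i) (@measurable _ (\bar R)) >>.

Definition same_distribution {d} {T : measurableType d} (P : probability T R)
    (I : Type) (X Y : I -> T -> \bar R) :=
  forall A : set (I -> \bar R), sigma_of (fun i (f : I -> \bar R) => f i) A ->
    P [set t | A (X^~ t)] = P [set t | A (Y^~ t)].

Definition independent_systems {d} {T : measurableType d}
    (P : probability T R) (F G : set (set T)) :=
  forall A B, F A -> G B -> P (A `&` B) = (P A * P B)%E.

End families.

Section quasi_Bernoulli.
Context {R : realType} {d : measure_display} {Omega : measurableType d}.
Context (P : probability Omega R) (b : nat) (hb : (2 <= b)%N).

(* A random (probability) measure is a (probability) kernel from Omega.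
   mul j and mur j stand for the random measures written with lower index j
   and with upper index (j) respectively; only j >= 1 is constrained.
   Relations between random variables hold almost surely. *)
Record quasi_Bernoulli_independent (mu : R.-pker Omega ~> symb hb)
    (C : R) (mul mur : nat -> R.-ker Omega ~> symb hb) : Prop := {
  qBi_const : 0 < C ;
  qBi_quasi : forall j, (0 < j)%N ->
    {ae P, forall om, forall (v : j.-tuple (letter hb)) (w : word hb),
      (C^-1%:E * (mul j om (cylinder v) * mur j om (cylinder (sval w)))
         <= mu om (cylinder (v ++ sval w)))%E /\
      (mu om (cylinder (v ++ sval w))
         <= C%:E * (mul j om (cylinder v) * mur j om (cylinder (sval w))))%E} ;
  qBi_bounds : forall r : letter hb,
    let m1 := fun om => mu om (cylinder [:: r]) in
    [/\ (0 < ess_inf P m1)%E, (ess_inf P m1 <= ess_sup P m1)%E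
      & (ess_sup P m1 < +oo)%E] ;
  qBi_law : forall j, (0 < j)%N ->
    same_distribution P
      (fun (w : word hb) om => mur j om (cylinder (sval w)))
      (fun (w : word hb) om => mu om (cylinder (sval w))) ;
  qBi_indep : forall j, (0 < j)%N ->
    independent_systems P
      (sigma_of (fun (v : j.-tuple (letter hb)) om => mul j om (cylinder v)))
      (sigma_of (fun (w : word hb) om => mur j om (cylinder (sval w)))) }.

Definition tau_n (m : set (symb hb) -> \bar R) (q : R) (n : nat) : R :=
  - n%:R^-1 *
  (ln (\sum_(w : n.-tuple (letter hb)) fine (m (cylinder w)) `^ q) / ln b%:R).

Definition tau_measure (m : set (symb hb) -> \bar R) (q : R) : \bar R :=
  limn_einf (fun n => (tau_n m q n)%:E).

(* The deterministic function tau is the almost sure value of tau_mu. *)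
Definition is_tau (mu : R.-pker Omega ~> symb hb) (tau : R -> R) :=
  {ae P, forall om, forall q : R, tau_measure (mu om) q = (tau q)%:E}.

Definition counting_function (n : nat) (m : set (symb hb) -> \bar R) (a eps : R) : nat :=
  #|[pred w : n.-tuple (letter hb) |
      ((b%:R `^ (- (n%:R * (a + eps))))%:E <= m (cylinder w))%E
      && (m (cylinder w) <= (b%:R `^ (- (n%:R * (a - eps))))%:E)%E]|.

End quasi_Bernoulli.

Definition twice_continuously_differentiable {R : realType} (f : R -> R) :=
  [/\ forall x, derivable f x 1, forall x, derivable (derive1 f) x 1
    & continuous (derive1 (derive1 f))].

(* Main.v *)
Require Import Defs.
From HB Require Import structures.
From mathcomp Require Import all_boot all_order all_algebra.
From mathcomp Require Import all_classical all_reals all_analysis.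
From mathcomp Require Import measurable_realfun ess_sup_inf.
From mathcomp Require Import ring lra zify.

Set Implicit Arguments.
Unset Strict Implicit.
Unset Printing Implicit Defensive.

Import Order.TTheory GRing.Theory Num.Theory.
Import numFieldNormedType.Exports.

Local Open Scope classical_set_scope.
Local Open Scope ring_scope.

(** Write S n q for the logarithm of the sum of the mu([w])^q over the words w
    of length n.  The quasi-Bernoulli inequalities make S almost additive: up
    to an error that does not depend on n and m, S (n + m) q is the sum of a
    quantity close to S n q and of an independent copy of S m q.  The theorem
    follows from a concentration inequality for such processes.

    Means.  The mean e n q of S n q is additive up to a bounded error, hence at
    bounded distance from a linear function of n (mean_drift).  The
    concentration inequality gives the strong law of large numbers, which
    identifies the slope as - tau(q) ln b (mean_tau).

    Concentration.  Cut a word of length n into blocks of length m close to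
    n^(1/3).  At the parameters l = 1/m^2 and l = - 1/m^2, each of the about
    m^2 blocks multiplies the Laplace transform of S n q - e n q by at most
    exp(O(1/m^2)): the almost additivity errors contribute |l|, and the
    fluctuation of a block, which is O(m), contributes l^2 m^2 (cmgf_block).
    So the transform is bounded, and S n q deviates from its mean by g n^(3/4)
    with probability O(exp(- g n^(1/12))) (deviation_stretched).

    Uniformity.  S n q is Lipschitz in q with a constant of order n, so it is
    enough to control it on a grid of mesh 1/n.  The exceptional event so
    obtained has the same probability for each of the copies of mu, and this
    probability is O(exp(- 2 ln(n+1)^2) / (n (n+1))).  Its sum over
    n >= exp(sqrt(alpha ln j)) is O(j^-2), and the Borel-Cantelli lemma leaves
    finitely many exceptional j (mur_eventually_unexceptional).

    Counting.  As eps n ^ 2 >= n^(-1/4), outside of the exceptional events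
    S n q differs from - n tau(q) ln b by a small fraction of n (eps n)^2, for
    all q in a neighbourhood of K at once.  The upper bound on the number of
    words is then a Markov inequality (card_level_set_le).  For the lower
    bound, the words whose mass is outside of the window are removed from the
    sum of the mu([w])^q by comparison with the exponents q + h and q - h: since
    tau is C^2, taking h proportional to eps n gains a factor
    b^(- const n (eps n)^2), so half of the sum is carried by the words inside
    the window, and all of these have nearly the same weight
    (card_level_set_ge, counting_bounds). *)

(** * Integrals of independent, equidistributed and bounded variables *)

(** The law of the pair (X, Y) is a product measure since the two agree on
    rectangles; Tonelli then separates the integral. *)
Lemma independent_integralM d (T : measurableType d) (R : realType)
    (P : probability T R) (X Y : T -> R) :
  measurable_fun setT X -> measurable_fun setT Y ->
  (forall t, 0 <= X t) -> (forall t, 0 <= Y t) ->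
  (forall A B, measurable A -> measurable B ->
    P (X @^-1` A `&` Y @^-1` B) = P (X @^-1` A) * P (Y @^-1` B))%E ->
  (\int[P]_t (X t * Y t)%:E = \int[P]_t (X t)%:E * \int[P]_t (Y t)%:E)%E.
Proof.
move=> mX mY X0 Y0 XY.
have mXY : measurable_fun setT (fun t => (X t, Y t)).
  exact: measurable_fun_pair.
pose X' : {mfun T >-> R} := HB.pack X (isMeasurableFun.Build _ _ _ _ _ mX).
pose Y' : {mfun T >-> R} := HB.pack Y (isMeasurableFun.Build _ _ _ _ _ mY).
pose XY' : {mfun T >-> (R * R)%type} :=
  HB.pack (fun t => (X t, Y t)) (isMeasurableFun.Build _ _ _ _ _ mXY).
pose PX := distribution P X'.
pose PY := distribution P Y'.
pose PXY := distribution P XY'.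
have E : forall C, measurable C -> (PX \x PY)%E C = PXY C.
  apply: product_measure_unique => A B mA mB.
  rewrite /PXY /PX /PY /distribution /pushforward /= -XY//.
(* Tonelli asks for a function that is nonnegative on the whole plane, hence the
   absolute values. *)
pose f (z : R * R) := (`|z.1| * `|z.2|)%:E.
have mf : measurable_fun setT f.
  by apply/measurable_EFinP/measurable_funM; apply: measurableT_comp => //.
have f0 z : (0 <= f z)%E by rewrite lee_fin mulr_ge0.
have mn : measurable_fun setT (fun x : R => `|x|%:E).
  by apply/measurable_EFinP; exact: normr_measurable.
have n0 (x : R) : (0 <= `|x|%:E)%E by rewrite lee_fin.
transitivity (\int[PX \x PY]_z f z)%E.
  transitivity (\int[PXY]_z f z)%E.
    rewrite ge0_integral_distribution//; apply: eq_integral => t _.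
    by rewrite /f /= !ger0_norm.
  by apply: eq_measure_integral => C mC _; exact/esym/E.
rewrite fubini_tonelli1// /fubini_F /f /=.
under eq_integral.
  move=> x _; under eq_integral do rewrite EFinM.
  rewrite ge0_integralZl//; over.
rewrite ge0_integralZr//; last by apply: integral_ge0.
by rewrite !ge0_integral_distribution//; congr (_ * _)%E;
  apply: eq_integral => t _ /=; rewrite ger0_norm.
Qed.

Lemma same_law_ge0_integral d (T : measurableType d) (R : realType)
    (P : probability T R) (X Y : T -> R) (f : R -> R) :
  measurable_fun setT X -> measurable_fun setT Y ->
  (forall A, measurable A -> P (X @^-1` A) = P (Y @^-1` A)) ->
  measurable_fun setT f -> (forall x, 0 <= f x) ->
  (\int[P]_t (f (X t))%:E = \int[P]_t (f (Y t))%:E)%E.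
Proof.
move=> mX mY XY mf f0.
have -> : (fun t => (f (X t))%:E) = (EFin \o f) \o X by [].
have -> : (fun t => (f (Y t))%:E) = (EFin \o f) \o Y by [].
have mf' : measurable_fun setT (EFin \o f) by exact/measurable_EFinP.
rewrite -[LHS](ge0_integral_pushforward mX P measurableT mf'); last first.
  by move=> y _; rewrite lee_fin.
rewrite -[RHS](ge0_integral_pushforward mY P measurableT mf'); last first.
  by move=> y _; rewrite lee_fin.
by apply: eq_measure_integral => A mA _; exact: XY.
Qed.

Lemma same_law_integral d (T : measurableType d) (R : realType)
    (P : probability T R) (X Y : T -> R) :
  measurable_fun setT X -> measurable_fun setT Y ->
  (forall A, measurable A -> P (X @^-1` A) = P (Y @^-1` A)) ->
  (\int[P]_t (X t)%:E = \int[P]_t (Y t)%:E)%E.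
Proof.
move=> mX mY XY; rewrite integralE [RHS]integralE; congr (_ - _)%E.
  have e (Z : T -> R) t : ((fun t => (Z t)%:E)^\+%E t = (Num.max (Z t) 0)%:E)%E.
    by rewrite funeposE EFin_max.
  under eq_integral do rewrite e; under [RHS]eq_integral do rewrite e.
  apply: (@same_law_ge0_integral _ _ _ P X Y (fun x => Num.max x 0)) => //.
    by apply: measurable_maxr => //; exact: measurable_cst.
  by move=> x; rewrite le_max lexx orbT.
have e (Z : T -> R) t : ((fun t => (Z t)%:E)^\-%E t = (Num.max (- Z t) 0)%:E)%E.
  by rewrite funenegE -EFinN EFin_max.
under eq_integral do rewrite e; under [RHS]eq_integral do rewrite e.
apply: (@same_law_ge0_integral _ _ _ P X Y (fun x => Num.max (- x) 0)) => //.
  by apply: measurable_maxr => //; exact: measurable_cst.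
by move=> x; rewrite le_max lexx orbT.
Qed.

Lemma ae_bounded_integrable d (T : measurableType d) (R : realType)
    (P : probability T R) (X : T -> R) (M : R) :
  measurable_fun setT X -> {ae P, forall t, `|X t| <= M} ->
  P.-integrable setT (EFin \o X).
Proof.
move=> mX XM; apply/integrableP; split; first exact/measurable_EFinP.
apply: (@le_lt_trans _ _ (\int[P]_t (`|M|)%:E)%E).
  apply: ae_ge0_le_integral => //.
  - by apply: measurableT_comp => //; exact/measurable_EFinP.
  - move: XM; apply: filterS => t XM _.
    by rewrite lee_fin (le_trans XM)// ler_norm.
by rewrite integral_cst//= probability_setT mule1 ltry.
Qed.

Lemma measurable_set_le d (T : measurableType d) (R : realType) (f g : T -> R) :
  measurable_fun setT f -> measurable_fun setT g ->
  measurable [set t | f t <= g t].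
Proof.
move=> /measurable_EFinP mf /measurable_EFinP mg.
by have := measurable_lee measurableT mf mg; rewrite setTI;
  under eq_set do rewrite lee_fin.
Qed.

(** * Elementary bounds and a Borel-Cantelli lemma *)

(** The block length used in the concentration inequality: m is the integer
    part of n^(1/3), so that n / m is of order m^2 while a deviation n^(3/4)
    still exceeds m^2 by a factor n^(1/12). *)
Lemma cube_root_block (R : realType) n : (0 < n)%N ->
  exists m, [/\ (0 < m)%N, (n <= 8 * m ^ 3)%N &
    m%:R ^+ 2 * n%:R `^ 12^-1 <= n%:R `^ (3 / 4) :> R].
Proof.
move=> n0; have nR : 0 < n%:R :> R by rewrite ltr0n.
have n1 : 1 <= n%:R :> R by rewrite ler1n.
pose x : R := n%:R `^ 3^-1.
have x1 : 1 <= x by rewrite -[leLHS](powRr0 n%:R) ler_powR.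
have x3 : x ^+ 3 = n%:R.
  by rewrite -powR_mulrn ?powR_ge0// -powRrM mulVf// powRr1// ltW.
have x0 : 0 <= x by rewrite (le_trans _ x1).
have := truncn_itv x0; set m := Num.truncn x => /andP[mx xm].
have m0 : (0 < m)%N by rewrite /m truncn_gt0.
exists m; split=> //.
  have x2m : x <= (2 * m)%:R.
    by rewrite (le_trans (ltW xm))// ler_nat; lia.
  rewrite -(ler_nat R) -x3; apply: (@le_trans _ _ ((2 * m)%:R ^+ 3)).
    by rewrite lerXn2r// nnegrE.
  by rewrite -natrX ler_nat expnMn.
have -> : n%:R `^ (3 / 4) = x ^+ 2 * n%:R `^ 12^-1 :> R.
  rewrite -powR_mulrn// -powRrM -powRD; last by rewrite gt_eqF ?implybT.
  by congr powR; field.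
by rewrite ler_wpM2r ?powR_ge0// lerXn2r// nnegrE.
Qed.

(** With u = ln(n+1), the exponent c n^(1/12) grows at least like u^3, which
    beats the 2 u^2 + 4 u demanded by the right-hand side. The square of the
    logarithm is what makes a tail over n >= exp(sqrt(ln j)) a power of j. *)
Lemma stretched_exp_decay (R : realType) (c : R) : 0 < c ->
  exists2 M : R, 0 <= M & forall n, (0 < n)%N ->
    n%:R * expR (- (c * n%:R `^ 12^-1)) <=
    M * expR (- 2 * ln n.+1%:R ^+ 2) / (n%:R * n.+1%:R).
Proof.
move=> c0; pose c' := c / 12 ^+ 4; pose C := 6 / c' + 1.
have c'0 : 0 < c' by rewrite divr_gt0// exprn_gt0.
have C1 : 1 <= C by rewrite lerDr divr_ge0// ltW.
have cC : 6 <= c' * C.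
  by rewrite mulrDr mulrCA mulfV ?gt_eqF//; lra.
exists (expR (2 * C ^+ 2 + 4 * C)); first exact: expR_ge0.
move=> n n0; have nR : 0 < n%:R :> R by rewrite ltr0n.
have n1 : 1 <= n%:R :> R by rewrite ler1n.
have N0 : 0 < n.+1%:R :> R by rewrite ltr0n.
set u := ln n.+1%:R.
have u0 : 0 <= u by rewrite ln_ge0// ler1n.
have eu : expR u = n.+1%:R by rewrite lnK ?posrE.
have h1 : c' * u ^+ 3 <= c * n%:R `^ 12^-1.
  have a : u ^+ 3 / (6 * 12 ^+ 3) <= expR (u / 12).
    have := @expR_ge1Dxn R (u / 12) 2; rewrite divr_ge0// => /(_ isT).
    have -> : (u / 12) ^+ 3 / 3`!%:R = u ^+ 3 / (6 * 12 ^+ 3) :> R.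
      by rewrite (_ : 3`! = 6%N)//; field.
    by lra.
  have b : expR (u / 12) <= 2 * n%:R `^ 12^-1.
    have -> : expR (u / 12) = n.+1%:R `^ 12^-1.
      by rewrite /powR gt_eqF// mulrC.
    apply: (@le_trans _ _ ((2 * n)%:R `^ 12^-1)).
      by rewrite ge0_ler_powR ?nnegrE// ler_nat; lia.
    rewrite natrM powRM// ler_wpM2r ?powR_ge0//.
    rewrite -[leRHS]powRr1//; apply: ler_powR; rewrite ?ler1n//.
    by rewrite invf_le1// ler1n.
  have : c * (u ^+ 3 / (6 * 12 ^+ 3) / 2) <= c * n%:R `^ 12^-1.
    by rewrite ler_pM2l// ler_pdivrMr// (le_trans a)// (le_trans b)// mulrC.
  rewrite [X in X <= _ -> _](_ : _ = c' * u ^+ 3)//; by rewrite /c'; field.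
(* C is chosen with c' C >= 6, so that beyond C the cube dominates. *)
have h2 : 2 * u ^+ 2 + 4 * u <= c' * u ^+ 3 + (2 * C ^+ 2 + 4 * C).
  have [uC|uC] := leP u C.
    have : 0 <= c' * u ^+ 3 by rewrite mulr_ge0 ?exprn_ge0// ltW.
    have : u ^+ 2 <= C ^+ 2 by rewrite lerXn2r ?nnegrE//; lra.
    by lra.
  have : 6 * u ^+ 2 <= c' * u ^+ 3.
    rewrite [u ^+ 3]exprS mulrA ler_wpM2r ?sqr_ge0//.
    by apply: (le_trans cC); rewrite ler_pM2l// ltW.
  by nra.
rewrite ler_pdivlMr ?mulr_gt0//.
have -> : n%:R * expR (- (c * n%:R `^ 12^-1)) * (n%:R * n.+1%:R) =
   (n%:R ^+ 2 * n.+1%:R) * expR (- (c * n%:R `^ 12^-1)) by ring.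
apply: (@le_trans _ _ (expR (4 * u) * expR (- (c * n%:R `^ 12^-1)))).
  rewrite ler_wpM2r ?expR_ge0// expRM_natl eu.
  have : n%:R <= n.+1%:R :> R by rewrite ler_nat.
  have : 1 <= n.+1%:R :> R by rewrite ler1n.
  move: (n.+1%:R) => z z1 nz.
  apply: (@le_trans _ _ (z ^+ 2 * z)).
    by rewrite ler_pM2r ?lerXn2r ?nnegrE//; lra.
  by rewrite -exprSr ler_weXn2l.
by rewrite -!expRD ler_expR; lra.
Qed.

(** For a centred X this bounds the mean of exp X by that of exp(2 X^2): the
    linear term disappears on integration. *)
Lemma expR_le_add (R : realType) (x : R) : expR x <= x + expR (2 * x ^+ 2).
Proof.
have h2 : 1 + 2 * x ^+ 2 <= expR (2 * x ^+ 2) by exact: expR_ge1Dx.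
suff [h|h] : expR x <= 1 + x + 2 * x ^+ 2 \/ 1 <= x.
- by lra.
- suff : expR x <= expR (2 * x ^+ 2) by lra.
  by rewrite ler_expR; nra.
have [h|h] := leP 1 x; first by right.
(* Below 1 the claim follows from expR x <= 1 + x + 2 x^2, which for x <= 0
   comes from expR x <= 1 / (1 - x) and for x > 0 from
   expR x <= 1 / (1 - x/2)^2. *)
left; have [x0|x0] := leP x 0.
  have [xN|xN] := leP x (-1).
    have : expR x <= 1 by rewrite expR_le1.
    by nra.
  have e0 := expR_gt0 x.
  have : expR x * (1 - x) <= 1.
    rewrite -[leRHS](expRxMexpNx_1 x) ler_pM2l//.
    by have := expR_ge1Dx (- x); lra.
  by nra.
have -> : expR x = expR (x / 2) ^+ 2 by rewrite expr2 -expRD; congr expR; lra.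
have e0 := expR_gt0 (x / 2).
have : expR (x / 2) * (1 - x / 2) <= 1.
  rewrite -[leRHS](expRxMexpNx_1 (x / 2)) ler_pM2l//.
  by have := expR_ge1Dx (- (x / 2)); lra.
move: e0; set y := expR _ => y0 hy.
have y1 : y ^+ 2 * (1 - x / 2) ^+ 2 <= 1.
  by rewrite -exprMn expr_le1// mulr_ge0//; lra.
have p : 1 <= (1 - x / 2) ^+ 2 * (1 + x + 2 * x ^+ 2).
  rewrite [leRHS](_ : _ = 1 + x ^+ 2 / 4 * ((1 - x) * (5 - 2 * x))); last by field.
  by rewrite lerDl mulr_ge0// ?divr_ge0 ?sqr_ge0// mulr_ge0; lra.
rewrite -(@ler_pM2r _ ((1 - x / 2) ^+ 2)); last by rewrite exprn_gt0; lra.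
by rewrite (le_trans y1)// mulrC.
Qed.

Lemma telescope_sum_le (R : realType) (x : R) N : (0 < N)%N -> 0 <= x ->
  (\sum_(N <= k <oo) (x / (k%:R * k.+1%:R))%:E <= x%:E)%E.
Proof.
move=> N0 x0; apply: lime_le.
  by apply: is_cvg_nneseries => k _ _; rewrite lee_fin divr_ge0// mulr_ge0.
apply: nearW => n; have [Nn|nN] := leqP N n; last first.
  by rewrite big_geq ?lee_fin// ltnW.
rewrite sumEFin lee_fin.
have -> : \sum_(N <= k < n) x / (k%:R * k.+1%:R) = x / N%:R - x / n%:R.
  rewrite (telescope_sumr_eq (fun k => - (x / k%:R)))//; first by ring.
  move=> k /andP[Nk _].
  have k0 : k%:R != 0 :> R by rewrite pnatr_eq0 -lt0n (leq_trans N0).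
  have k1 : k.+1%:R != 0 :> R by rewrite pnatr_eq0.
  have E : k.+1%:R = k%:R + 1 :> R by rewrite natr1.
  rewrite E in k1 *; field; apply/andP; split=> //.
have : 0 <= x / n%:R by rewrite divr_ge0.
have : x / N%:R <= x by rewrite ler_pdivrMr ?ltr0n// ler_peMr// ler1n.
by lra.
Qed.

Lemma borel_cantelli d (T : measurableType d) (R : realType)
    (P : probability T R) (F : nat -> set T) (M : R) : 0 <= M ->
  (forall k, (0 < k)%N -> measurable (F k)) ->
  (forall k, (0 < k)%N -> P (F k) <= (M / (k%:R * k.+1%:R))%:E)%E ->
  {ae P, forall t, \forall k \near \oo, ~ F k t}.
Proof.
move=> M0 mF PF; pose G k := F k.+1.
have mG k : measurable (G k) by exact: mF.
have : P (lim_sup_set G) = 0%E.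
  apply: lim_sup_set_cvg0 => //.
  apply: (@le_lt_trans _ _ M%:E); last by rewrite ltry.
  apply: le_trans (telescope_sum_le (ltn0Sn 0) M0).
  rewrite -(@nneseries_addn _ (fun k => (M / (k%:R * k.+1%:R))%:E) 1); last first.
    by move=> k; rewrite lee_fin divr_ge0// mulr_ge0.
  by apply: lee_nneseries => // k _; rewrite /G -addn1; apply: PF; rewrite addn1.
move=> h; exists (lim_sup_set G); split=> //.
  apply: bigcap_measurable; first by exists 0%N.
  by move=> k _; apply: bigcup_measurable.
move=> t /= nG n _; apply: contrapT => nGn; apply: nG.
exists n.+1 => // k /= nk Fk; apply: nGn; exists k.-1 => /=; first by lia.
by rewrite /G prednK//; lia.
Qed.

(** * Concentration of almost additive processes *)

Lemma measurable_expR_affine d (T : measurableType d) (R : realType)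
    (X : T -> R) l c : measurable_fun setT X ->
  measurable_fun setT (fun t => expR (l * (X t - c))).
Proof.
move=> mX; apply: measurableT_comp => //; apply: measurable_funM => //.
by apply: measurable_funB.
Qed.

Section mean.
Context d (T : measurableType d) (R : realType) (P : probability T R).

Definition mean (X : T -> R) : R := fine (\int[P]_t (X t)%:E).

Definition ae_bounded (X : T -> R) :=
  measurable_fun setT X /\ exists M, {ae P, forall t, `|X t| <= M}.

Lemma ae_bounded_int X : ae_bounded X -> P.-integrable setT (EFin \o X).
Proof. by case=> mX [M]; exact: ae_bounded_integrable. Qed.

Lemma EFin_mean X : ae_bounded X -> (mean X)%:E = (\int[P]_t (X t)%:E)%E.
Proof.
by move=> bX; rewrite fineK//; apply: integrable_fin_num => //; exact: ae_bounded_int.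
Qed.

Lemma ae_boundedD X Y : ae_bounded X -> ae_bounded Y -> ae_bounded (X \+ Y).
Proof.
move=> [mX [M XM]] [mY [N YN]]; split; first exact: measurable_funD.
exists (M + N); move: XM YN; apply: filterS2 => t XM YN /=.
by rewrite (le_trans (ler_normD _ _))// lerD.
Qed.

Lemma meanD X Y : ae_bounded X -> ae_bounded Y ->
  mean (X \+ Y) = mean X + mean Y.
Proof.
move=> bX bY; apply: EFin_inj; rewrite EFinD !EFin_mean//; last exact: ae_boundedD.
under eq_integral do rewrite EFinD.
by rewrite integralD//; exact: ae_bounded_int.
Qed.

Lemma mean_cst c : mean (cst c) = c.
Proof.
by rewrite /mean (integral_cst P measurableT c%:E)/= probability_setT mule1.
Qed.

Lemma mean_dist X Y k : ae_bounded X -> ae_bounded Y ->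
  {ae P, forall t, `|X t - Y t| <= k} -> `|mean X - mean Y| <= k.
Proof.
move=> bX bY XYk.
have [mX _] := bX; have [mY _] := bY.
rewrite -lee_fin -abse_EFin EFinB !EFin_mean//.
rewrite -integralB_EFin//; [|exact: ae_bounded_int|exact: ae_bounded_int].
have mXY : measurable_fun setT (fun x => (X x)%:E - (Y x)%:E)%E.
  by apply/measurable_EFinP; exact: measurable_funB.
apply: (le_trans (le_abse_integral _ _ _)) => //.
have k0 : 0 <= k.
  apply: contrapT => /negP; rewrite -ltNge => k0.
  have : (P setT = 0)%E.
    apply/negligibleP => //.
    move: XYk; rewrite /almost_everywhere/=; apply: negligibleS => t _ /=.
    by move=> h; have := le_lt_trans h k0; rewrite normr_lt0.
  by rewrite probability_setT => /eqP; rewrite onee_eq0.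
rewrite (_ : k%:E = \int[P]_t k%:E)%E; last first.
  by rewrite (integral_cst P measurableT k%:E)/= probability_setT mule1.
apply: ae_ge0_le_integral => //.
  exact: measurableT_comp.
by move: XYk; apply: filterS => t h _; rewrite -EFinB abse_EFin lee_fin.
Qed.

Lemma mean_le X Y : ae_bounded X -> ae_bounded Y ->
  {ae P, forall t, X t <= Y t} -> mean X <= mean Y.
Proof.
move=> bX bY XY; have [mX _] := bX; have [mY _] := bY.
rewrite -subr_ge0 -lee_fin EFinB !EFin_mean//.
rewrite -integralB_EFin//; [|exact: ae_bounded_int|exact: ae_bounded_int].
have mXY : measurable_fun setT (fun x => (Y x)%:E - (X x)%:E)%E.
  by apply/measurable_EFinP; exact: measurable_funB.
rewrite (@ae_eq_integral _ _ _ P setT (fun t => `|(Y t)%:E - (X t)%:E|%E))//.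
- by apply: integral_ge0.
- exact: measurableT_comp.
- move: XY; apply: filterS => t h _.
  by rewrite -EFinB abse_EFin ger0_norm ?subr_ge0.
Qed.

Lemma ae_le_integralZ (X Y : T -> R) c : 0 <= c ->
  measurable_fun setT X -> measurable_fun setT Y ->
  (forall t, 0 <= X t) -> (forall t, 0 <= Y t) ->
  {ae P, forall t, X t <= c * Y t} ->
  (\int[P]_t (X t)%:E <= c%:E * \int[P]_t (Y t)%:E)%E.
Proof.
move=> c0 mX mY X0 Y0 XY.
rewrite -(@ge0_integralZl_EFin _ _ _ P setT measurableT (fun t => (Y t)%:E)) //.
- apply: ae_ge0_le_integral => //.
  + by move=> t _; rewrite lee_fin.
  + exact/measurable_EFinP.
  + by move=> t _; rewrite -EFinM lee_fin mulr_ge0.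
  + by apply/measurable_EFinP/measurable_funM.
  + by move: XY; apply: filterS => t h _; rewrite -EFinM lee_fin.
- by move=> t _; rewrite lee_fin.
- exact/measurable_EFinP.
Qed.

End mean.

(** U n is to be close to S n and V n m is to be a copy of S m independent of
    U n. Independence holds between U n and V n m only: S n itself is in
    general not independent of V n m, which is why U has to appear. *)
Record almost_additive d (T : measurableType d) (R : realType)
    (P : probability T R) (S : nat -> T -> R) (U : nat -> T -> R)
    (V : nat -> nat -> T -> R) (k A : R) : Prop := {
  aa_meas : forall n, (0 < n)%N -> measurable_fun setT (S n) ;
  aa_measU : forall n, (0 < n)%N -> measurable_fun setT (U n) ;
  aa_measV : forall n m, (0 < n)%N -> (0 < m)%N -> measurable_fun setT (V n m) ;
  aa_bound : forall n, (0 < n)%N -> {ae P, forall t, `|S n t| <= n%:R * A} ;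
  aa_left : forall n, (0 < n)%N -> {ae P, forall t, `|U n t - S n t| <= k} ;
  aa_add : forall n m, (0 < n)%N -> (0 < m)%N ->
    {ae P, forall t, `|S (n + m)%N t - (U n t + V n m t)| <= k} ;
  aa_law : forall n m, (0 < n)%N -> (0 < m)%N -> forall B, measurable B ->
    P (V n m @^-1` B) = P (S m @^-1` B) ;
  aa_indep : forall n m, (0 < n)%N -> (0 < m)%N -> forall B C,
    measurable B -> measurable C ->
    (P (U n @^-1` B `&` V n m @^-1` C) =
     P (U n @^-1` B) * P (V n m @^-1` C))%E }.

Section almost_additive.
Context d (T : measurableType d) (R : realType) (P : probability T R).
Variables (S U : nat -> T -> R) (V : nat -> nat -> T -> R) (k A : R).
Hypothesis aa : almost_additive P S U V k A.

Notation e n := (mean P (S n)).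

Lemma aa_bS n : (0 < n)%N -> ae_bounded P (S n).
Proof.
by move=> n0; split; [exact: (aa_meas aa)|exists (n%:R * A); exact: (aa_bound aa)].
Qed.

Lemma aa_bU n : (0 < n)%N -> ae_bounded P (U n).
Proof.
move=> n0; split; first exact: (aa_measU aa).
exists (k + n%:R * A); move: (aa_bound aa n0) (aa_left aa n0).
by apply: filterS2 => t; rewrite !ler_norml; lra.
Qed.

Lemma aa_bV n m : (0 < n)%N -> (0 < m)%N -> ae_bounded P (V n m).
Proof.
move=> n0 m0; split; first exact: (aa_measV aa).
have [_ [M UM]] := aa_bU n0; have nm0 : (0 < n + m)%N by rewrite addn_gt0 n0.
exists (M + k + (n + m)%:R * A).
move: UM (aa_bound aa nm0) (aa_add aa n0 m0).
by apply: filterS3 => t; rewrite !ler_norml; lra.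
Qed.

Lemma aa_k_ge0 : 0 <= k.
Proof.
have := mean_dist (aa_bU (ltn0Sn 0)) (aa_bS (ltn0Sn 0)) (aa_left aa (ltn0Sn 0)).
exact: le_trans.
Qed.

Lemma mean_add n m : (0 < n)%N -> (0 < m)%N ->
  `|e (n + m)%N - (e n + e m)| <= 2 * k.
Proof.
move=> n0 m0; have nm0 : (0 < n + m)%N by rewrite addn_gt0 n0.
have h1 := mean_dist (aa_bU n0) (aa_bS n0) (aa_left aa n0).
have h2 : mean P (V n m) = e m.
  rewrite /mean; congr fine; apply: same_law_integral => //;
    [exact: (aa_measV aa)|exact: (aa_meas aa)|exact: (aa_law aa)].
have h3 := mean_dist (aa_bS nm0) (ae_boundedD (aa_bU n0) (aa_bV n0 m0))
  (aa_add aa n0 m0).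
rewrite meanD// in h3; [|exact: aa_bU|exact: aa_bV].
by move: h1 h3; rewrite -h2 !ler_norml; lra.
Qed.

(** The Laplace transform of the centred variable, as an extended real so that
    no integrability is at stake in its manipulation. *)
Definition cmgf n l : \bar R := (\int[P]_t (expR (l * (S n t - e n)))%:E)%E.

Lemma cmgf_ge0 n l : (0 <= cmgf n l)%E.
Proof. by apply: integral_ge0 => t _; rewrite lee_fin expR_ge0. Qed.

(** Replacing S (n + m) by U n + V n m costs k, the almost additivity of the
    means 2 k, and going back from U n to S n another k. *)
Lemma cmgf_add n m l : (0 < n)%N -> (0 < m)%N ->
  (cmgf (n + m) l <= (expR (4 * `|l| * k))%:E * (cmgf n l * cmgf m l))%E.
Proof.
move=> n0 m0; have nm0 : (0 < n + m)%N by rewrite addn_gt0 n0.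
have mS := aa_meas aa; have mU := aa_measU aa n0; have mV := aa_measV aa n0 m0.
have hk := mean_add n0 m0.
have step1 : (cmgf (n + m) l <=
    (expR (3 * `|l| * k))%:E *
     \int[P]_t (expR (l * (U n t - e n)) * expR (l * (V n m t - e m)))%:E)%E.
  apply: ae_le_integralZ.
  - exact: expR_ge0.
  - exact/measurable_expR_affine/mS.
  - by apply/measurable_funM; exact: measurable_expR_affine.
  - by move=> t; exact: expR_ge0.
  - by move=> t; rewrite mulr_ge0 ?expR_ge0.
  move: (aa_add aa n0 m0); apply: filterS => t ht.
  rewrite -!expRD ler_expR -mulrDr.
  set x := S _ t - _; set y := (U n t - _ + _).
  have : `|x - y| <= 3 * k.
    by move: ht hk; rewrite /x /y !ler_norml; lra.
  move=> xy; have : `|l * (x - y)| <= 3 * `|l| * k.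
    by rewrite normrM (mulrC 3) -mulrA ler_wpM2l.
  by rewrite ler_norml; lra.
have step2 : (\int[P]_t (expR (l * (U n t - e n)) *
       expR (l * (V n m t - e m)))%:E =
    \int[P]_t (expR (l * (U n t - e n)))%:E * cmgf m l)%E.
  have mf c : measurable_fun setT (fun x : R => expR (l * (x - c))).
    exact: (measurable_expR_affine _ _ (@measurable_id _ R setT)).
  have iUV : forall B C, measurable B -> measurable C ->
      (P ((fun t => expR (l * (U n t - e n))) @^-1` B `&`
          (fun t => expR (l * (V n m t - e m))) @^-1` C) =
       P ((fun t => expR (l * (U n t - e n))) @^-1` B) *
       P ((fun t => expR (l * (V n m t - e m))) @^-1` C))%E.
    move=> B C mB mC.
    have mB' := mf (e n) measurableT _ mB; have mC' := mf (e m) measurableT _ mC.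
    rewrite setTI in mB'; rewrite setTI in mC'.
    exact: (aa_indep aa n0 m0 mB' mC').
  rewrite (independent_integralM (measurable_expR_affine l (e n) mU)
    (measurable_expR_affine l (e m) mV) _ _ iUV); last 2 first.
  - by move=> t; exact: expR_ge0.
  - by move=> t; exact: expR_ge0.
  congr (_ * _)%E.
  apply: (@same_law_ge0_integral _ _ _ P (V n m) (S m)
    (fun x => expR (l * (x - e m)))).
  - exact: mV.
  - exact: mS.
  - exact: (aa_law aa).
  - exact: (measurable_expR_affine _ _ (@measurable_id _ R setT)).
  - by move=> x; exact: expR_ge0.
have step3 : (\int[P]_t (expR (l * (U n t - e n)))%:E <=
    (expR (`|l| * k))%:E * cmgf n l)%E.
  apply: ae_le_integralZ.
  - exact: expR_ge0.
  - exact: measurable_expR_affine.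
  - exact/measurable_expR_affine/mS.
  - by move=> t; exact: expR_ge0.
  - by move=> t; exact: expR_ge0.
  move: (aa_left aa n0); apply: filterS => t ht.
  rewrite -!expRD ler_expR.
  have : `|l * (U n t - S n t)| <= `|l| * k by rewrite normrM ler_wpM2l.
  by rewrite ler_norml; lra.
apply: (le_trans step1); rewrite step2 muleA.
rewrite (_ : expR (4 * `|l| * k) = expR (3 * `|l| * k) * expR (`|l| * k)); last first.
  by rewrite -expRD; congr expR; lra.
rewrite EFinM -!muleA lee_wpmul2l ?lee_fin ?expR_ge0//.
by rewrite muleA lee_wpmul2r// cmgf_ge0.
Qed.

(** The centred variable is bounded by 2 n A, so its square contributes at most
    2 (2 l n A)^2 in expR_le_add. *)
Lemma cmgf_le n l : (0 < n)%N ->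
  (cmgf n l <= (expR (8 * (l * n%:R * A) ^+ 2))%:E)%E.
Proof.
move=> n0; have mS := aa_meas aa n0; have bS := aa_bS n0.
have eA : `|e n| <= n%:R * A.
  have b0 : ae_bounded P (cst 0 : T -> R).
    by split => //; exists 0; apply/aeW => t; rewrite normr0.
  have := @mean_dist _ _ _ P (S n) (cst 0) (n%:R * A) bS b0.
  rewrite mean_cst subr0; apply.
  by move: (aa_bound aa n0); apply: filterS => t; rewrite subr0.
pose Y t := l * (S n t - e n).
have mY : measurable_fun setT Y.
  by apply: measurable_funM => //; apply: measurable_funB.
have YA : {ae P, forall t, `|Y t| <= `|l| * (2 * n%:R * A)}.
  move: (aa_bound aa n0); apply: filterS => t h.
  rewrite /Y normrM ler_wpM2l// (le_trans (ler_normB _ _))//; lra.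
have bY : ae_bounded P Y by split => //; exists (`|l| * (2 * n%:R * A)).
have eY : mean P Y = 0.
  have bc c : ae_bounded P (cst c : T -> R).
    by split => //; exists `|c|; apply/aeW.
  have bSc : ae_bounded P (S n \+ cst (- e n)) by exact: ae_boundedD.
  apply: EFin_inj; rewrite EFin_mean//.
  under eq_integral do rewrite EFinM.
  rewrite integralZl//; last exact: (ae_bounded_int bSc).
  have := meanD bS (bc (- e n)); rewrite mean_cst subrr => h.
  by rewrite -[X in (_ * X)%E](EFin_mean bSc) h mule0.
set K := expR _.
have bK : ae_bounded P (cst K : T -> R).
  by split => //; exists `|K|; apply/aeW.
have -> : (K%:E = \int[P]_t ((Y \+ cst K) t)%:E)%E.
  rewrite -EFin_mean; last exact: ae_boundedD.
  by rewrite meanD// eY add0r mean_cst.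
have bE : ae_bounded P (fun t => expR (Y t)).
  split; first exact: measurableT_comp.
  exists (expR (`|l| * (2 * n%:R * A))); move: YA; apply: filterS => t h.
  rewrite ger0_norm ?expR_ge0// ler_expR (le_trans _ h)//; exact: ler_norm.
have ae_nn : {ae P, forall t, expR (Y t) <= Y t + K}.
  move: YA; apply: filterS => t h; apply: (le_trans (expR_le_add _)).
  rewrite lerD2l ler_expR.
  have : Y t ^+ 2 <= (`|l| * (2 * n%:R * A)) ^+ 2.
    rewrite -(real_normK (num_real (Y t))) lerXn2r ?nnegrE//.
    exact: le_trans h.
  have : `|l| ^+ 2 = l ^+ 2 by rewrite -normrX ger0_norm ?sqr_ge0.
  rewrite !exprMn => ->; lra.
have -> : cmgf n l = (mean P (fun t => expR (Y t)))%:E by rewrite EFin_mean.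
rewrite -EFin_mean; last exact: ae_boundedD.
by rewrite lee_fin mean_le//; exact: ae_boundedD.
Qed.

(** The remainder block has length r with 0 < r <= m, rather than 0 <= r < m,
    because almost additivity says nothing about empty blocks. *)
Lemma cmgf_block m r i l : (0 < m)%N -> (0 < r <= m)%N ->
  (cmgf (r + i * m) l <=
    (expR (i.+1%:R * (4 * `|l| * k + 8 * (l * m%:R * A) ^+ 2)))%:E)%E.
Proof.
move=> m0 /andP[r0 rm]; have k0 := aa_k_ge0.
elim: i => [|i IH].
  rewrite mul0n addn0 mul1r (le_trans (cmgf_le l r0))// lee_fin ler_expR.
  rewrite ler_wpDl ?mulr_ge0// ler_pM2l// !exprMn.
  rewrite ler_wpM2r ?sqr_ge0// ler_wpM2l ?sqr_ge0//.
  by rewrite lerXn2r// ?nnegrE// ler_nat.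
rewrite mulSn addnCA addnC.
have rim : (0 < r + i * m)%N by rewrite addn_gt0 r0.
rewrite (le_trans (cmgf_add _ rim m0))//.
set a := 4 * _ * _ in IH *; set c := 8 * _ in IH *.
rewrite [in leRHS](_ : expR _ =
  expR a * (expR (i.+1%:R * (a + c)) * expR c)); last first.
  by rewrite -!expRD -[i.+2%:R]natr1; congr expR; ring.
rewrite EFinM lee_wpmul2l ?lee_fin ?expR_ge0// EFinM.
by rewrite lee_pmul ?cmgf_ge0// cmgf_le.
Qed.

Definition cmgf_cst := expR (36 * k + 72 * A ^+ 2).

(** There are at most 9 m^2 blocks; each contributes 4 |l| k and
    8 (l m A)^2, both of order 1/m^2 when |l| m^2 <= 1. *)
Lemma cmgf_bounded m n l : (0 < m)%N -> (0 < n <= 8 * m ^ 3)%N ->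
  `|l| * m%:R ^+ 2 <= 1 -> (cmgf n l <= cmgf_cst%:E)%E.
Proof.
move=> m0 /andP[n0 nm] lm; have k0 := aa_k_ge0.
have En : n = ((n.-1 %% m).+1 + (n.-1 %/ m) * m)%N.
  by rewrite addSn addnC -divn_eq prednK.
have rm : (0 < (n.-1 %% m).+1 <= m)%N by rewrite /= ltn_mod.
rewrite En (le_trans (cmgf_block _ l m0 rm))// lee_fin ler_expR.
set i := (_ %/ _)%N.
have im : i.+1%:R <= 9 * m%:R ^+ 2 :> R.
  have : (i.+1 <= 9 * m ^ 2)%N.
    rewrite ltn_divLR//.
    have : (8 * m ^ 3 <= 9 * m ^ 2 * m)%N by rewrite -mulnA -expnSr leq_mul2r orbT.
    by move=> h; rewrite prednK// (leq_trans nm).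
  by rewrite -(ler_nat R) natrM natrX.
have m1 : 1 <= m%:R :> R by rewrite ler1n.
have l2 : (l * m%:R) ^+ 2 * m%:R ^+ 2 <= 1.
  have -> : (l * m%:R) ^+ 2 * m%:R ^+ 2 = (`|l| * m%:R ^+ 2) ^+ 2.
    have l2n : `|l| ^+ 2 = l ^+ 2 by rewrite -normrX ger0_norm ?sqr_ge0.
    by rewrite [RHS]exprMn l2n; ring.
  by rewrite expr_le1// mulr_ge0 ?sqr_ge0.
set x := `|l| * _ in lm; set y := (_ ^+ 2 * _) in l2.
apply: (@le_trans _ _ (9 * m%:R ^+ 2 * (4 * `|l| * k + 8 * (l * m%:R * A) ^+ 2))).
  apply: ler_wpM2r => //; apply: addr_ge0; last by rewrite mulr_ge0 ?sqr_ge0.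
  by rewrite !mulr_ge0.
rewrite [leLHS](_ : _ = 36 * k * x + 72 * A ^+ 2 * y); last by rewrite /x /y; ring.
by rewrite lerD// ler_piMr// mulr_ge0 ?sqr_ge0.
Qed.

(** Exponential Markov inequality at the parameters 1/m^2 and - 1/m^2. *)
Lemma deviation m n (x : R) : (0 < m)%N -> (0 < n <= 8 * m ^ 3)%N ->
  (P [set t | (x <= `|S n t - e n|)%R] <=
    (2 * cmgf_cst * expR (- x / m%:R ^+ 2))%R%:E)%E.
Proof.
move=> m0 nm; have /andP[n0 _] := nm.
have mS := aa_meas aa n0.
pose l : R := (m%:R ^+ 2)^-1.
have m2 : 0 < m%:R ^+ 2 :> R by rewrite exprn_gt0// ltr0n.
have l0 : 0 < l by rewrite invr_gt0.
have half s : `|s| = l ->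
    (P [set t | (x * l <= s * (S n t - e n))%R] <=
     (cmgf_cst * expR (- x / m%:R ^+ 2))%R%:E)%E.
  move=> sl; pose Y t := s * (S n t - e n).
  have mY : measurable_fun setT Y.
    by apply: measurable_funM => //; apply: measurable_funB.
  pose Y' : {mfun T >-> R} := HB.pack Y (isMeasurableFun.Build _ _ _ _ _ mY).
  have := @chernoff _ _ _ P Y' 1 (x * l) ltr01.
  move=> /le_trans; apply.
  rewrite mul1r EFinM mulNr; apply: lee_wpmul2r; first by rewrite lee_fin expR_ge0.
  rewrite /mmt_gen_fun unlock.
  under eq_integral do rewrite /= mulr1.
  apply: (@cmgf_bounded m) => //.
  by rewrite sl mulVf// lt0r_neq0.
have sub : [set t | (x <= `|S n t - e n|)%R] `<=`
    [set t | (x * l <= l * (S n t - e n))%R] `|`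
    [set t | (x * l <= - l * (S n t - e n))%R].
  move=> t /=; rewrite ler_normr => /orP[h|h]; [left|right].
    by rewrite mulrC ler_pM2l.
  by rewrite mulNr -mulrN mulrC ler_pM2l.
have mx s : measurable [set t | (x * l <= s * (S n t - e n))%R].
  apply: measurable_set_le => //.
  by apply: measurable_funM => //; apply: measurable_funB.
rewrite (le_trans (le_measure _ _ _ sub))// ?inE.
- apply: measurable_set_le => //.
  by apply: measurableT_comp => //; exact: measurable_funB.
- exact: measurableU.
rewrite (le_trans (measureU2 _ _ _))//.
rewrite (_ : (2 * cmgf_cst * _)%R = cmgf_cst * expR (- x / m%:R ^+ 2) +
  cmgf_cst * expR (- x / m%:R ^+ 2)); last by ring.
by rewrite EFinD leeD// half// ?normrN gtr0_norm.
Qed.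

Lemma mean_mul n m : (0 < n)%N -> (0 < m)%N ->
  `|e (n * m)%N - n%:R * e m| <= 2 * k * n%:R.
Proof.
move=> n0 m0; case: n n0 => // n _; have k0 := aa_k_ge0.
elim: n => [|n IH]; first by rewrite mul1n !mul1r subrr normr0 mulr1 mulr_ge0.
have nm : (0 < n.+1 * m)%N by rewrite muln_gt0.
have := mean_add m0 nm; rewrite -mulSn; move: IH.
by rewrite -[n.+2%:R]natr1 !ler_norml; lra.
Qed.

(** Compare both sides with the mean at n * m. *)
Lemma mean_cross n m : (0 < n)%N -> (0 < m)%N ->
  `|m%:R * e n - n%:R * e m| <= 2 * k * (n%:R + m%:R).
Proof.
move=> n0 m0; have := mean_mul n0 m0; have := mean_mul m0 n0.
by rewrite mulnC !ler_norml; lra.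
Qed.

Lemma deviation_stretched n (c : R) : (0 < n)%N -> 0 < c ->
  (P [set t | (c * n%:R `^ (3 / 4) <= `|S n t - e n|)%R] <=
    (2 * cmgf_cst * expR (- (c * n%:R `^ 12^-1)))%R%:E)%E.
Proof.
move=> n0 c0; have [m [m0 nm mn]] := cube_root_block R n0.
have m2 : 0 < m%:R ^+ 2 :> R by rewrite exprn_gt0// ltr0n.
apply: (le_trans (deviation _ m0 _)); first by rewrite n0.
rewrite lee_fin ler_wpM2l//; first by rewrite mulr_ge0// expR_ge0.
rewrite ler_expR mulNr lerN2 ler_pdivlMr// -mulrA ler_pM2l//.
by rewrite mulrC.
Qed.

(** By mean_cross every (e n - 2 k) / n is at most every (e m + 2 k) / m; the
    slope is any number separating the two families. *)
Lemma mean_drift : exists l : R, forall n, (0 < n)%N -> `|e n - n%:R * l| <= 2 * k.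
Proof.
pose lo n := (e n.+1 - 2 * k) / n.+1%:R; pose hi n := (e n.+1 + 2 * k) / n.+1%:R.
have lohi n m : lo n <= hi m.
  rewrite /lo /hi ler_pdivrMr ?ltr0n// mulrAC ler_pdivlMr ?ltr0n//.
  have := mean_cross (ltn0Sn n) (ltn0Sn m).
  by rewrite ler_norml; lra.
exists (sup (range lo)) => n n0.
have ub : ubound (range lo) (hi n.-1) by move=> _ [m _ <-].
have h1 : lo n.-1 <= sup (range lo).
  by apply: ub_le_sup; [exists (hi n.-1)|exists n.-1].
have h2 : sup (range lo) <= hi n.-1 by apply: ge_sup => //; exists (lo 0%N), 0%N.
move: h1 h2; rewrite /lo /hi prednK//.
rewrite ler_pdivrMr ?ltr0n// ler_pdivlMr ?ltr0n// => h1 h2.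
by rewrite ler_norml; apply/andP; split; lra.
Qed.

(** At the scale n^(3/4) the deviation probabilities are summable, and
    n^(3/4) = o(n). *)
Lemma almost_additive_slln (l : R) :
  (forall n, (0 < n)%N -> `|e n - n%:R * l| <= 2 * k) ->
  {ae P, forall t, S n t / n%:R @[n --> \oo] --> l}.
Proof.
move=> el; have k0 := aa_k_ge0.
have [M M0 hM] := stretched_exp_decay (ltr01 : 0 < 1 :> R).
pose F n := [set t | (1 * n%:R `^ (3 / 4) <= `|S n t - e n|)%R].
have B0 : 0 <= 2 * cmgf_cst by rewrite mulr_ge0// expR_ge0.
have bc : {ae P, forall t, \forall n \near \oo, ~ F n t}.
  apply: (@borel_cantelli _ _ _ P F (2 * cmgf_cst * M)).
  - by rewrite mulr_ge0.
  - move=> n n0; have mS := aa_meas aa n0; apply: measurable_set_le => //.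
    by apply: measurableT_comp => //; exact: measurable_funB.
  - move=> n n0; rewrite (le_trans (deviation_stretched n0 ltr01))// lee_fin.
    rewrite -!mulrA ler_wpM2l// ler_wpM2l ?expR_ge0//.
    apply: (@le_trans _ _ (n%:R * expR (- (1 * n%:R `^ 12^-1)))).
      by rewrite ler_peMl ?expR_ge0// ler1n.
    apply: (le_trans (hM _ n0)); rewrite -mulrA ler_wpM2l// ler_piMl//.
    by rewrite expR_le1 mulNr oppr_le0 mulr_ge0 ?sqr_ge0.
move: bc; apply: filterS => t nF.
apply/cvgrPdist_le => eps eps0.
near=> n.
have n0 : (0 < n)%N by near: n; exists 1%N.
have nR : 0 < n%:R :> R by rewrite ltr0n.
have hF : `|S n t - e n| < n%:R `^ (3 / 4).
  by rewrite ltNge -[leLHS]mul1r; apply/negP; near: n.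
have h14 : 1 + 2 * k <= eps * n%:R `^ 4^-1.
  rewrite [leRHS]mulrC -ler_pdivrMr//.
  have x0 : 0 <= (1 + 2 * k) / eps 
    by apply: divr_ge0; [rewrite addr_ge0// mulr_ge0|exact: ltW].
  have -> : (1 + 2 * k) / eps = (((1 + 2 * k) / eps) ^+ 4) `^ 4^-1.
    by rewrite -powR_mulrn// -powRrM mulfV// powRr1.
  rewrite ge0_ler_powR ?nnegrE ?exprn_ge0//.
  near: n; exists (Num.truncn (((1 + 2 * k) / eps) ^+ 4)).+1 => // n /= hn.
  by rewrite (le_trans (ltW (truncnS_gt _)))// ler_nat.
have E : n%:R = n%:R `^ (3 / 4) * n%:R `^ 4^-1 :> R.
  rewrite -powRD; last by rewrite gt_eqF ?implybT.
  by rewrite -[LHS]powRr1 ?ltW//; congr powR; field.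
have p1 : 1 <= n%:R `^ (3 / 4) :> R.
  by rewrite -[leLHS](powRr0 n%:R) ler_powR// ler1n.
have -> : l - S n t / n%:R = (n%:R * l - S n t) / n%:R by field; exact: lt0r_neq0.
rewrite normrM normfV (gtr0_norm nR) ler_pdivrMr//.
have : `|n%:R * l - S n t| <= (1 + 2 * k) * n%:R `^ (3 / 4).
  have := el n n0.
  rewrite ler_norml => /andP[a b]; move: hF; rewrite ltr_norml => /andP[u v].
  by rewrite ler_norml; apply/andP; split; nra.
move=> /le_trans; apply.
rewrite [in leRHS]E mulrCA mulrC ler_wpM2l// powR_ge0//.
Unshelve. all: by end_near. Qed.
End almost_additive.

(** * Cylinders and sigma-algebras generated by families *)

Section cylinders.
Context (b : nat) (hb : (2 <= b)%N).

Lemma cylinder0 : cylinder [::] = [set: symb hb].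
Proof. by apply/seteqP; split. Qed.

Lemma cylinder_rcons (w : seq (letter hb)) a :
  cylinder (rcons w a) = cylinder w `&` [set x : symb hb | x (size w) = a].
Proof.
apply/seteqP; split=> x; rewrite /cylinder /= size_rcons mkseqS.
  by move=> /rcons_inj[-> ->].
by move=> [-> ->].
Qed.

Lemma measurable_coordinate i (a : letter hb) :
  measurable ([set x | x i = a] : set (symb hb)).
Proof.
apply: sub_sigma_algebra.
apply: (@open_comp _ _
  (proj i : prod_topology (fun _ => discrete_topology (letter hb)) -> _) [set a]).
  by move=> x _; exact: proj_continuous.
exact: discrete_open.
Qed.

Lemma measurable_cylinder (w : seq (letter hb)) :
  measurable (cylinder w : set (symb hb)).
Proof.
elim/last_ind: w => [|w a IH]; first by rewrite cylinder0.
by rewrite cylinder_rcons; apply: measurableI => //; exact: measurable_coordinate.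
Qed.

Lemma cylinder_split (R : realType) (m : {measure set (symb hb) -> \bar R})
    (w : seq (letter hb)) :
  (m (cylinder w) = \sum_(a : letter hb) m (cylinder (rcons w a)))%E.
Proof.
pose F (a : letter hb) := cylinder (rcons w a) : set (symb hb).
have mF (a : 'I_b) : measurable (F a) by exact: measurable_cylinder.
have tF : trivIset setT F.
  by move=> a c _ _ [x []]; rewrite /F !cylinder_rcons => -[_ <-] [_ <-].
transitivity (m (\big[setU/set0]_(a < b) F a)); last first.
  exact: (@measure_bigsetU_ord _ _ _ m b xpredT F).
congr (m _); apply/seteqP; split=> x.
  move=> wx; rewrite (bigD1 (x (size w) : 'I_b))//; left.
  by rewrite /F cylinder_rcons.
apply: (big_ind (fun A : set (symb hb) => A x -> cylinder w x)) => //.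
  by move=> A B hA hB [/hA|/hB].
by move=> a _; rewrite /F cylinder_rcons => -[].
Qed.

End cylinders.

Section sigma_of.
Context (R : realType).

(** A member of the generating family is measurable for the sigma-algebra that
    the family generates; this lets the usual closure properties of measurable
    functions produce the events required by independence and by the equality
    of laws. *)
Lemma measurable_sigma_of (T : pointedType) (I : Type) (X : I -> T -> \bar R) i :
  measurable_fun setT (X i : g_sigma_algebraType
    (\bigcup_i preimage_set_system setT (X i) (@measurable _ (\bar R))) -> \bar R).
Proof.
move=> _ B mB; apply: sub_sigma_algebra.
by exists i => //; exists B.
Qed.

Definition log_sum (I : finType) (q : R) (g : I -> \bar R) : R :=
  ln (\sum_i fine (g i) `^ q).

Lemma measurable_log_sum d (T : measurableType d) (I : finType) q
    (G : I -> T -> \bar R) : (forall i, measurable_fun setT (G i)) ->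
  measurable_fun setT (fun t => log_sum q (G^~ t)).
Proof.
move=> mG; apply: measurableT_comp; first exact: measurable_ln.
apply: (@measurable_sum _ T R setT I _ (fun i t => fine (G i t) `^ q)) => i.
apply: (measurableT_comp (f := fun x : R => x `^ q)); first exact: measurable_powR.
exact: measurableT_comp (mG i).
Qed.

Lemma sigma_of_log_sum (T : pointedType) (I : Type) (X : I -> T -> \bar R)
    (J : finType) (f : J -> I) q (B : set R) : measurable B ->
  sigma_of X ((fun t => log_sum q (fun j => X (f j) t)) @^-1` B).
Proof.
move=> mB; have := @measurable_log_sum _ (g_sigma_algebraType
  (\bigcup_i preimage_set_system setT (X i) (@measurable _ (\bar R)))) J q
  (fun j => X (f j)) (fun j => @measurable_sigma_of T I X (f j)).
by move=> /(_ measurableT B mB); rewrite setTI.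
Qed.

Lemma same_distribution_fun d (T : measurableType d) (P : probability T R)
    (I : Type) (X Y : I -> T -> \bar R)
    (h : g_sigma_algebraType (\bigcup_i preimage_set_system setT
           (fun f : I -> \bar R => f i) (@measurable _ (\bar R))) -> R) B :
  same_distribution P X Y -> measurable_fun setT h -> measurable B ->
  P [set t | B (h (X^~ t))] = P [set t | B (h (Y^~ t))].
Proof.
move=> XY mh mB; apply: (XY (h @^-1` B)).
by have := mh measurableT B mB; rewrite setTI.
Qed.

Lemma measurable_family d (T : measurableType d) (I : Type)
    (X : I -> T -> \bar R) (A : set (I -> \bar R)) :
  (forall i, measurable_fun setT (X i)) ->
  sigma_of (fun i (f : I -> \bar R) => f i) A ->
  measurable [set t | A (X^~ t)].
Proof.
move=> mX mA.
pose G := \bigcup_i preimage_set_system setT (fun f : I -> \bar R => f i)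
  (@measurable _ (\bar R)).
have : measurable_fun setT (fun t => X^~ t : g_sigma_algebraType G).
  apply: (@measurability _ _ T (g_sigma_algebraType G) setT _ G) => //.
  move=> _ [B [i _ [C mC <-]] <-].
  by rewrite setTI; exact: mX.
by move=> /(_ measurableT A mA); rewrite setTI.
Qed.

(** Almost sure properties of mu that are expressed by cylinder masses pass to
    its copies through this lemma. *)
Lemma same_distribution_ae d (T : measurableType d) (P : probability T R)
    (I : Type) (X Y : I -> T -> \bar R) (A : set (I -> \bar R)) :
  same_distribution P X Y ->
  (forall i, measurable_fun setT (X i)) ->
  (forall i, measurable_fun setT (Y i)) ->
  sigma_of (fun i (f : I -> \bar R) => f i) A ->
  {ae P, forall t, A (Y^~ t)} -> {ae P, forall t, A (X^~ t)}.
Proof.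
move=> XY mX mY mA AY.
have mA' : sigma_of (fun i (f : I -> \bar R) => f i) (~` A).
  exact: (@measurableC _ (g_sigma_algebraType _) A mA).
have /negligibleP AY0 : P.-negligible [set t | (~` A) (Y^~ t)] by exact: AY.
have AX0 : P [set t | (~` A) (X^~ t)] = 0%E.
  by rewrite XY// AY0//; exact: (measurable_family mY mA').
by apply/negligibleP => //; exact: (measurable_family mX mA').
Qed.

End sigma_of.

(** * Logarithms of power sums *)

Lemma dist_lnP (R : realType) (x y k : R) : 0 < x -> 0 < y ->
  `|ln x - ln y| <= k <-> x <= expR k * y /\ y <= expR k * x.
Proof.
move=> x0 y0.
have h (u v : R) : 0 < u -> 0 < v -> (u <= expR k * v) = (ln u - ln v <= k).
  move=> u0 v0; rewrite -[in RHS]ler_expR expRB !lnK ?posrE//.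
  by rewrite ler_pdivrMr.
rewrite !h// ler_norml; split.
  by move=> /andP[]; lra.
by move=> [? ?]; apply/andP; split; lra.
Qed.

Lemma sumr_all_gt0 (R : realType) (I : finType) (i0 : I) (f : I -> R) :
  (forall i, 0 < f i) -> 0 < \sum_i f i.
Proof.
by move=> f0; rewrite (bigD1 i0)//= ltr_pwDl// sumr_ge0// => i _; exact: ltW.
Qed.

(** A multiplicative comparison of all the terms passes to the sums. *)
Lemma dist_ln_sum (R : realType) (I : finType) (i0 : I) (a b : I -> R) (k : R) :
  (forall i, 0 < a i) -> (forall i, 0 < b i) ->
  (forall i, `|ln (a i) - ln (b i)| <= k) ->
  `|ln (\sum_i a i) - ln (\sum_i b i)| <= k.
Proof.
move=> a0 b0 ab.
apply/dist_lnP; rewrite ?(sumr_all_gt0 i0)//; split; rewrite mulr_sumr;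
  apply: ler_sum => i _;
  by have /(dist_lnP _ (a0 i) (b0 i))[] := ab i.
Qed.

Lemma dist_log_sum (R : realType) (I : finType) (i0 : I) (q k : R)
    (g h : I -> \bar R) :
  (forall i, 0 < fine (g i)) -> (forall i, 0 < fine (h i)) ->
  (forall i, `|ln (fine (g i)) - ln (fine (h i))| <= k) ->
  `|log_sum q g - log_sum q h| <= `|q| * k.
Proof.
move=> g0 h0 gh; apply: (dist_ln_sum i0) => i; rewrite ?powR_gt0//.
by rewrite !ln_powR -mulrBr normrM ler_wpM2l.
Qed.

Lemma dist_log_sum_exponent (R : realType) (I : finType) (i0 : I) (q q' k : R)
    (g : I -> \bar R) :
  (forall i, 0 < fine (g i)) -> (forall i, `|ln (fine (g i))| <= k) ->
  `|log_sum q g - log_sum q' g| <= `|q - q'| * k.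
Proof.
move=> g0 gk; apply: (dist_ln_sum i0) => i; rewrite ?powR_gt0//.
by rewrite !ln_powR -mulrBl normrM ler_wpM2l.
Qed.

Lemma log_sum_bound (R : realType) (I : finType) (i0 : I) (q k : R)
    (g : I -> \bar R) :
  (forall i, 0 < fine (g i)) -> (forall i, `|ln (fine (g i))| <= k) ->
  `|log_sum q g| <= ln #|I|%:R + `|q| * k.
Proof.
move=> g0 gk; have := dist_log_sum_exponent i0 q 0 g0 gk; rewrite subr0.
have -> : log_sum 0 g = ln #|I|%:R.
  rewrite /log_sum; congr ln; under eq_bigr do rewrite powRr0.
  by rewrite sumr_const.
have : 0 <= ln #|I|%:R :> R.
  by rewrite ln_ge0// ler1n; apply/card_gt0P; exists i0.
set u := ln _; set s := log_sum _ _ => u0.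
rewrite !ler_norml => /andP[? ?]; apply/andP; split; lra.
Qed.

(** * Quasi-Bernoulli measures as almost additive processes *)

Section words.
Context (b : nat) (hb : (2 <= b)%N).

Definition tuple_word n (n0 : (0 < n)%N) (w : n.-tuple (letter hb)) : word hb.
Proof. by exists (val w); rewrite -size_eq0 size_tuple -lt0n. Defined.

Lemma cat_tuple_bij n m :
  bijective (fun p : n.-tuple (letter hb) * m.-tuple (letter hb) =>
    cat_tuple p.1 p.2).
Proof.
apply: inj_card_bij; last by rewrite card_prod !card_tuple expnD.
move=> [v w] [v' w'] /= /(congr1 val)/= /eqP.
rewrite eqseq_cat ?size_tuple// => /andP[/eqP vv /eqP ww].
by congr pair; apply: val_inj.
Qed.

Lemma sum_cat_tuple (R : realType) n m (f : seq (letter hb) -> R) :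
  \sum_(u : (n + m).-tuple (letter hb)) f u =
  \sum_(p : n.-tuple (letter hb) * m.-tuple (letter hb)) f (p.1 ++ p.2).
Proof. by rewrite (reindex _ (onW_bij _ (cat_tuple_bij n m))). Qed.

Definition const_tuple n : n.-tuple (letter hb) :=
  [tuple (Ordinal (ltnW hb) : letter hb) | i < n].

End words.

Section quasi_Bernoulli_ae.
Context (R : realType) (d : measure_display) (Omega : measurableType d).
Context (P : probability Omega R) (b : nat) (hb : (2 <= b)%N).
Context (mu : R.-pker Omega ~> symb hb) (C : R).
Context (mul mur : nat -> R.-ker Omega ~> symb hb).
Hypothesis hmu : quasi_Bernoulli_independent P mu C mul mur.

Local Notation letter := (letter hb).

Let C0 : 0 < C. Proof. exact: qBi_const hmu. Qed.

Lemma measurable_kernel_cylinder (k : R.-ker Omega ~> symb hb) (w : seq letter) :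
  measurable_fun setT (fun om => k om (cylinder w)).
Proof. by apply: measurable_kernel; exact: measurable_cylinder. Qed.

Lemma mu_cylinder_le1 om (w : seq letter) : (mu om (cylinder w) <= 1)%E.
Proof.
rewrite -[leRHS](_ : mu om setT = 1%E); last exact: prob_kernel.
by apply: le_measure; rewrite ?inE//; exact: measurable_cylinder.
Qed.

Lemma sum_mu_letters om : (\sum_(a : letter) mu om (cylinder [:: a]) = 1)%E.
Proof. by rewrite -(cylinder_split _ [::]) cylinder0 prob_kernel. Qed.

Lemma letter_lower_bound : exists c : R, [/\ 0 < c, c <= 1 &
  {ae P, forall om, forall a : letter, (c%:E <= mu om (cylinder [:: a]))%E}].
Proof.
have h (a : letter) : exists c : R, 0 < c /\
    {ae P, forall om, (c%:E <= mu om (cylinder [:: a]))%E}.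
  have [e0 _ _] := qBi_bounds hmu a.
  have [c [c0 ce]] : exists c : R, 0 < c /\
      (c%:E <= ess_inf P (fun om => mu om (cylinder [:: a])))%E.
    move: e0; case: (ess_inf _ _) => [r| |]//; last by exists 1; rewrite leey.
    by rewrite lte_fin => r0; exists r.
  by exists c; split => //; apply/ess_infP.
have {h} [c hc] := choice h.
exists (\big[Num.min/1]_a c a); split.
- by apply: lt_bigmin => // a _; have [] := hc a.
- exact: bigmin_le_id.
- apply: filter_forall => a; have [_] := hc a; apply: filterS => om.
  by apply: le_trans; rewrite lee_fin; exact: bigmin_le_cond.
Qed.

Lemma mur_letters c j : (0 < j)%N ->
  {ae P, forall om, forall a : letter, (c%:E <= mu om (cylinder [:: a]))%E} ->
  {ae P, forall om, (forall a : letter, (c%:E <= mur j om (cylinder [:: a]))%E) /\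
     (\sum_(a : letter) mur j om (cylinder [:: a]) = 1)%E}.
Proof.
move=> j0 hc.
pose lw (a : letter) : word hb := exist _ [:: a] isT.
pose A := [set g : word hb -> \bar R |
  (forall a, (c%:E <= g (lw a))%E) /\ (\sum_a g (lw a) = 1)%E].
apply: (same_distribution_ae (A := A) (qBi_law hmu j0)).
- by move=> w; exact: measurable_kernel_cylinder.
- by move=> w; exact: (measurable_kernel_cylinder mu).
- pose F := g_sigma_algebraType (\bigcup_i preimage_set_system setT
     (fun f : word hb -> \bar R => f i) (@measurable _ (\bar R))).
  have mF w : measurable_fun setT (fun f : F => f w).
    exact: (@measurable_sigma_of R _ _ (fun w (f : word hb -> \bar R) => f w)).
  suff : measurable (A : set F) by [].
  have -> : (A : set F) = \bigcap_(a in [set: letter]) [set g | (c%:E <= g (lw a))%E]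
       `&` [set g | (\sum_a g (lw a) = 1)%E].
    apply/seteqP; split => g [h1 h2]; split => // a; first by move=> _; exact: h1.
    exact: (h1 a I).
  apply: measurableI.
    apply: fin_bigcap_measurable; first exact: finite_finset.
    move=> a _; rewrite -[X in measurable X]setTI; apply: measurable_lee => //.
  rewrite -[X in measurable X]setTI; apply: measurable_eqe => //.
  by apply: emeasurable_sum => a; exact: mF.
- move: hc; apply: filterS => om h; split; first exact: h.
  exact: sum_mu_letters.
Qed.

(** Sum the quasi-Bernoulli inequalities for v followed by one letter over that
    letter: the copy mur j has total mass 1 almost surely. *)
Lemma mul_comparison j : (0 < j)%N ->
  {ae P, forall om, forall v : j.-tuple letter,
     (C^-1%:E * mul j om (cylinder v) <= mu om (cylinder v) /\
      mu om (cylinder v) <= C%:E * mul j om (cylinder v))%E}.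
Proof.
move=> j0; have [c [_ _ hc]] := letter_lower_bound.
move: (mur_letters j0 hc) (qBi_quasi hmu j0).
apply: filterS2 => om [_ h1] hq v.
have qa (a : letter) := hq v (exist _ [:: a] isT).
have E (x : R) : 0 <= x -> (\sum_(a : letter)
    (x%:E * (mul j om (cylinder v) * mur j om (cylinder [:: a]))) =
    x%:E * mul j om (cylinder v))%E.
  move=> x0; rewrite -ge0_sume_distrr//.
  by rewrite -ge0_sume_distrr// h1 mule1.
rewrite (cylinder_split (mu om) v).
have CV0 : 0 <= C^-1 by rewrite invr_ge0 ltW.
rewrite -(E _ CV0) -(E _ (ltW C0)).
split; apply: lee_sum => a _; rewrite -cats1; by have [] := qa a.
Qed.

(** Adding a letter a to v multiplies the mass by at least the mass of a under
    a copy of mu, up to the constants of the quasi-Bernoulli inequality and of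
    mul_comparison. *)
Lemma mu_lower_bound : exists c : R, [/\ 0 < c, c <= 1 &
  {ae P, forall om, forall n (w : n.-tuple letter),
    ((c ^+ n)%:E <= mu om (cylinder w))%E}].
Proof.
have [c0 [c00 c01 hc]] := letter_lower_bound.
(* The minimum with c0 handles words of one letter. *)
exists (Num.min c0 (C^-1 * (C^-1 * c0))); split.
- by rewrite lt_min c00/= !mulr_gt0 ?invr_gt0.
- by rewrite ge_min c01.
set c := Num.min _ _.
have c0' : 0 < c by rewrite lt_min c00/= !mulr_gt0 ?invr_gt0.
have all_l := ae_foralln (fun n => mul_comparison (ltn0Sn n)).
have all_r := ae_foralln (fun n => mur_letters (ltn0Sn n) hc).
have all_q := ae_foralln (fun n => qBi_quasi hmu (ltn0Sn n)).
have all_lr : {ae P, forall om, (forall n, forall v : n.+1.-tuple letter,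
     (C^-1%:E * mul n.+1 om (cylinder v) <= mu om (cylinder v) /\
      mu om (cylinder v) <= C%:E * mul n.+1 om (cylinder v))%E) /\
   forall n a, (c0%:E <= mur n.+1 om (cylinder [:: a]))%E}.
  move: all_l all_r; apply: filterS2 => om hl hr; split => // n a.
  by have [] := hr n.
move: hc all_q all_lr; apply: filterS3 => om {}hc hq [hl hr] n w.
suff : ((c ^+ size w)%:E <= mu om (cylinder w))%E by rewrite size_tuple.
elim/last_ind: (tval w) => [|v a IH].
  by rewrite /= expr0 cylinder0 prob_kernel.
have [->|v0] := eqVneq v [::].
  by rewrite /= expr1 (le_trans _ (hc a))// lee_fin ge_min lexx.
have sv : (size v).-1.+1 = size v by rewrite prednK// lt0n size_eq0.
have hv : size v == (size v).-1.+1 by rewrite sv.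
have [hqa _] := hq (size v).-1 (Tuple hv) (exist _ [:: a] isT).
have [_ hla] := hl (size v).-1 (Tuple hv).
have hra := hr (size v).-1 a.
rewrite /= cats1 in hqa.
rewrite size_rcons exprSr (le_trans _ hqa)//.
rewrite (@le_trans _ _ (C^-1%:E * ((C^-1%:E * (c ^+ size v)%:E) * c0%:E))%E)//.
  rewrite -!EFinM lee_fin.
  rewrite (_ : C^-1 * (C^-1 * c ^+ size v * c0) =
    c ^+ size v * (C^-1 * (C^-1 * c0))); last by ring.
  by rewrite ler_pM2l ?exprn_gt0// ge_min lexx orbT.
apply: lee_wpmul2l; first by rewrite lee_fin invr_ge0 ltW.
apply: lee_pmul => //.
- by rewrite -EFinM lee_fin mulr_ge0 ?invr_ge0 ?exprn_ge0 ?ltW.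
- by rewrite lee_fin ltW.
- rewrite lee_pdivrMl// (le_trans IH)//.
Qed.


Local Notation K0 := `|ln C|.

Lemma le_expR_abs_ln : C <= expR K0 /\ C^-1 <= expR K0.
Proof.
have e : C^-1 = expR (- ln C) by rewrite expRN lnK ?posrE.
rewrite -{1}[C](@lnK R) ?posrE// e !ler_expR; split; first exact: ler_norm.
by rewrite -normrN ler_norm.
Qed.

Section lower_bound.
Variable c : R.
Hypotheses (c0 : 0 < c) (c1 : c <= 1).
Hypothesis mu_lower : {ae P, forall om, forall n (w : n.-tuple letter),
    ((c ^+ n)%:E <= mu om (cylinder w))%E}.

Lemma mur_bounds j m : (0 < j)%N -> (0 < m)%N ->
  {ae P, forall om, forall w : m.-tuple letter,
    ((c ^+ m)%:E <= mur j om (cylinder w) <= 1)%E}.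
Proof.
move=> j0 m0.
pose A := [set g : word hb -> \bar R |
  forall w : m.-tuple letter, ((c ^+ m)%:E <= g (tuple_word m0 w) <= 1)%E].
apply: (same_distribution_ae (A := A) (qBi_law hmu j0)).
- by move=> w; exact: measurable_kernel_cylinder.
- by move=> w; exact: (measurable_kernel_cylinder mu).
- pose F := g_sigma_algebraType (\bigcup_i preimage_set_system setT
     (fun f : word hb -> \bar R => f i) (@measurable _ (\bar R))).
  have mF w : measurable_fun setT (fun f : F => f w).
    exact: (@measurable_sigma_of R _ _ (fun w (f : word hb -> \bar R) => f w)).
  suff : measurable (A : set F) by [].
  have -> : (A : set F) = \bigcap_(w in [set: m.-tuple letter])
     ([set g | ((c ^+ m)%:E <= g (tuple_word m0 w))%E] `&`
      [set g | (g (tuple_word m0 w) <= 1)%E]).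
    apply/seteqP; split => g h w; first by move=> _; apply/andP; exact: h.
    by apply/andP; exact: (h w I).
  apply: fin_bigcap_measurable; first exact: finite_finset.
  move=> w _; apply: measurableI; rewrite -[X in measurable X]setTI;
    exact: measurable_lee.
- move: mu_lower; apply: filterS => om h w.
  by rewrite h mu_cylinder_le1.
Qed.

Lemma fine_bounds (x : \bar R) n : ((c ^+ n)%:E <= x <= 1)%E ->
  [/\ (fine x)%:E = x, 0 < fine x & `|ln (fine x)| <= n%:R * - ln c].
Proof.
case: x => [x| |]; rewrite ?leye_eq ?andbF//= !lee_fin => /andP[cx x1].
have x0 : 0 < x by rewrite (lt_le_trans _ cx)// exprn_gt0.
split => //; rewrite ler0_norm ?ln_le0// mulrN lerN2.
by rewrite mulr_natl -lnXn// ler_ln ?posrE// exprn_gt0.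
Qed.

Lemma mu_bounds : {ae P, forall om, forall n (w : n.-tuple letter),
  [/\ (fine (mu om (cylinder w)))%:E = mu om (cylinder w),
    0 < fine (mu om (cylinder w)) &
    `|ln (fine (mu om (cylinder w)))| <= n%:R * - ln c]}.
Proof.
move: mu_lower; apply: filterS => om h n w; apply: fine_bounds.
by rewrite h mu_cylinder_le1.
Qed.

(** The logarithmic form of mul_comparison: mul n and mu may be exchanged on
    words of length n at a bounded cost. *)
Lemma mul_near_mu n : (0 < n)%N ->
  {ae P, forall om, forall v : n.-tuple letter,
   [/\ (fine (mul n om (cylinder v)))%:E = mul n om (cylinder v),
    0 < fine (mul n om (cylinder v)) &
    `|ln (fine (mul n om (cylinder v))) - ln (fine (mu om (cylinder v)))| <= K0]}.
Proof.
move=> n0; move: mu_bounds (mul_comparison n0); apply: filterS2 => om hbounds hl v.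
have [ex x0 _] := hbounds n v; have [] := hl v; rewrite -ex.
have : (0 <= mul n om (cylinder v))%E by [].
case: (mul n om (cylinder v)) => [y| |] //=; last first.
  by rewrite gt0_muley ?lte_fin ?invr_gt0.
rewrite -!EFinM !lee_fin => y0 l1 l2.
have yp : 0 < y.
  by rewrite lt_def y0 andbT; apply/eqP => y00; move: l2 x0;
    rewrite y00 mulr0 => l2; rewrite ltNge l2.
have [k1 k2] := le_expR_abs_ln.
split => //; apply/dist_lnP => //; split.
  rewrite (le_trans (_ : y <= C * fine (mu om (cylinder v))))//.
    by rewrite -ler_pdivrMl.
  by rewrite ler_wpM2r// ltW.
by rewrite (le_trans l2)// ler_wpM2r.
Qed.

Lemma quasi_Bernoulli_ln n m : (0 < n)%N -> (0 < m)%N ->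
  {ae P, forall om, forall (v : n.-tuple letter) (w : m.-tuple letter),
    [/\ 0 < fine (mul n om (cylinder v)), 0 < fine (mur n om (cylinder w)),
     0 < fine (mu om (cylinder (v ++ w))) &
    `|ln (fine (mu om (cylinder (v ++ w)))) -
      ln (fine (mul n om (cylinder v)) * fine (mur n om (cylinder w)))| <= K0]}.
Proof.
move=> n0 m0.
have hlr : {ae P, forall om, (forall v : n.-tuple letter,
   (fine (mul n om (cylinder v)))%:E = mul n om (cylinder v) /\
    0 < fine (mul n om (cylinder v))) /\
   forall w : m.-tuple letter, (fine (mur n om (cylinder w)))%:E =
     mur n om (cylinder w) /\ 0 < fine (mur n om (cylinder w))}.
  move: (mul_near_mu n0) (mur_bounds n0 m0); apply: filterS2 => om hl hr.
  split=> [v|w]; first by have [] := hl v.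
  by have [] := fine_bounds (hr w).
move: hlr mu_bounds (qBi_quasi hmu n0); apply: filterS3 => om [hl hr] hm hq v w.
have [ey y0] := hl v; have [ez z0] := hr w.
have [ex x0 _] := hm (n + m)%N (cat_tuple v w).
have [] := hq v (tuple_word m0 w); rewrite /= in ex x0 *.
rewrite -ey -ez -ex -!EFinM !lee_fin => l1 l2; split => //.
have yz0 : 0 < fine (mul n om (cylinder v)) * fine (mur n om (cylinder w)).
  by rewrite mulr_gt0.
have [k1 k2] := le_expR_abs_ln.
apply/dist_lnP => //; split.
  by rewrite (le_trans l2)// ler_wpM2r// ltW.
move: l1; rewrite ler_pdivrMl// => l1.
by rewrite (le_trans l1)// ler_wpM2r// ltW.
Qed.

Definition mu_sum q n om :=
  log_sum q (fun w : n.-tuple letter => mu om (cylinder w)).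
Definition mul_sum q n om :=
  log_sum q (fun w : n.-tuple letter => mul n om (cylinder w)).
Definition mur_sum q n m om :=
  log_sum q (fun w : m.-tuple letter => mur n om (cylinder w)).

Lemma card_words n : ln #|{: n.-tuple letter}|%:R = n%:R * ln b%:R :> R.
Proof.
rewrite card_tuple card_ord natrX lnXn ?mulr_natl//.
by rewrite ltr0n (ltn_trans _ hb).
Qed.

(** The partition function of mul n is measurable with respect to the first of
    the two independent sigma-algebras, that of mur n to the second; expanding
    the product of the two gives a sum over pairs of words that compares term by
    term with the partition function of mu at length n + m. *)
Lemma quasi_Bernoulli_almost_additive q :
  almost_additive P (mu_sum q) (mul_sum q) (mur_sum q)
    (`|q| * K0) (ln b%:R + `|q| * - ln c).
Proof.
have word0 n := const_tuple hb n.
split.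
- move=> n n0; apply: measurable_log_sum => w.
  exact: (measurable_kernel_cylinder mu).
- by move=> n n0; apply: measurable_log_sum => w; exact: measurable_kernel_cylinder.
- move=> n m n0 m0; apply: measurable_log_sum => w.
  exact: measurable_kernel_cylinder.
- move=> n n0; move: mu_bounds; apply: filterS => om h.
  have := @log_sum_bound _ _ (word0 n) q (n%:R * - ln c)
    (fun w : n.-tuple letter => mu om (cylinder w)).
  rewrite card_words => /(_ _ _)/le_trans; apply.
  + by move=> w; have [] := h n w.
  + by move=> w; have [] := h n w.
  + by rewrite le_eqVlt; apply/orP; left; apply/eqP; ring.
- move=> n n0; move: mu_bounds (mul_near_mu n0); apply: filterS2 => om hm hl.
  apply: (dist_log_sum (word0 n)).
  + by move=> w; have [] := hl w.
  + by move=> w; have [] := hm n w.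
  + by move=> w; have [] := hl w.
- move=> n m n0 m0; move: (quasi_Bernoulli_ln n0 m0); apply: filterS => om h.
  have hl (v : n.-tuple letter) : 0 < fine (mul n om (cylinder v)).
    by have [] := h v (word0 m).
  have hr (w : m.-tuple letter) : 0 < fine (mur n om (cylinder w)).
    by have [] := h (word0 n) w.
  rewrite /mu_sum /mul_sum /mur_sum /log_sum.
  rewrite -lnM ?posrE; [|by apply: (sumr_all_gt0 (word0 n)) => v; exact: powR_gt0|
    by apply: (sumr_all_gt0 (word0 m)) => w; exact: powR_gt0].
  rewrite (sum_cat_tuple n m (fun u => fine (mu om (cylinder u)) `^ q)).
  rewrite big_distrlr/= pair_bigA/=.
  apply: (dist_ln_sum (word0 n, word0 m)).
  + by move=> [v w]; have [_ _ x0 _] := h v w; exact: powR_gt0.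
  + by move=> [v w] /=; rewrite mulr_gt0 ?powR_gt0.
  + move=> [v w] /=; have [_ _ x0 hk] := h v w.
    rewrite -powRM; [|exact/ltW/hl|exact/ltW/hr].
    by rewrite !ln_powR -mulrBr normrM ler_wpM2l.
- move=> n m n0 m0 B mB.
  pose h (g : word hb -> \bar R) : R :=
    log_sum q (fun w : m.-tuple letter => g (tuple_word m0 w)).
  apply: (@same_distribution_fun R _ _ P _ _ _ h _ (qBi_law hmu n0)) => //.
  apply: measurable_log_sum => w.
  exact: (@measurable_sigma_of R _ _ (fun w (f : word hb -> \bar R) => f w)).
- move=> n m n0 m0 B D mB mD; apply: (qBi_indep hmu n0).
  + exact: (@sigma_of_log_sum R _ _ (fun (v : n.-tuple letter) om =>
      mul n om (cylinder v)) _ id q).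
  + exact: (@sigma_of_log_sum R _ _ (fun (w : word hb) om =>
      mur n om (cylinder (sval w))) _ (tuple_word m0) q).
Qed.

End lower_bound.
End quasi_Bernoulli_ae.

(** * Counting by exponential changes of weight *)

Section count.
Context (R : realType) (I : finType) (x : I -> R).
Hypothesis x0 : forall i, 0 < x i.

(** In logarithmic scale, the words counted by the counting function, with
    L = n ln b. *)
Definition level_set (L a eps : R) : {set I} :=
  [set i | - (L * (a + eps)) <= ln (x i) <= - (L * (a - eps))].

(** On the level set, the q-th power of the weight is exp(- L a q) up to
    exp(L |q| eps). *)
Lemma level_setP L a eps q i : i \in level_set L a eps ->
  `|q * ln (x i) + L * (a * q)| <= L * (`|q| * eps).
Proof.
rewrite inE => /andP[h1 h2].
have -> : q * ln (x i) + L * (a * q) = q * (ln (x i) + L * a) by ring.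
rewrite normrM mulrCA ler_wpM2l// ler_norml; apply/andP; split; lra.
Qed.

Lemma card_level_set_le L a eps q t :
  ln (\sum_i x i `^ q) <= L * t ->
  #|level_set L a eps|%:R <= expR (L * (a * q + `|q| * eps + t)).
Proof.
move=> hZ; set N := level_set _ _ _.
have [->|/card_gt0P[i0 _]] := posnP #|N|; first by rewrite expR_ge0.
have Z0 : 0 < \sum_i x i `^ q by apply: (sumr_all_gt0 i0) => i; exact: powR_gt0.
have {}hZ : \sum_i x i `^ q <= expR (L * t).
  by rewrite -ler_ln ?posrE ?expR_gt0// expRK.
have hN : #|N|%:R * expR (- (L * (a * q + `|q| * eps))) <= \sum_i x i `^ q.
  rewrite mulr_natl -sumr_const.
  apply: (@le_trans _ _ (\sum_(i in N) x i `^ q)).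
    apply: ler_sum => i iN; rewrite /powR gt_eqF// ler_expR.
    by have := level_setP q iN; rewrite ler_norml => /andP[]; lra.
  rewrite [leRHS](bigID [in N])/= lerDl sumr_ge0// => i _; exact: powR_ge0.
rewrite mulrDr expRD -ler_pdivrMl ?expR_gt0// -expRN mulrC.
exact: le_trans hN hZ.
Qed.

(** A weight above the window satisfies x^q <= exp(L (a - eps) h) x^(q+h), and
    one below it satisfies x^q <= exp(- L (a + eps) h) x^(q-h). By the bounds at
    q + h and q - h, each of the two groups therefore carries at most
    exp(- L r), hence a quarter, of the lower bound for the sum at q, and half
    of it is left for the level set. *)
Lemma card_level_set_ge L a eps q t h k dl r : 0 < h ->
  L * (- t - dl) <= ln (\sum_i x i `^ q) ->
  ln (\sum_i x i `^ (q + h)) <= L * (- t - a * h + k) ->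
  ln (\sum_i x i `^ (q - h)) <= L * (- t + a * h + k) ->
  0 <= L -> k - eps * h <= - dl - r -> ln 4 <= L * r -> (0 < #|I|)%N ->
  expR (L * (a * q - t - `|q| * eps - dl - r)) <= #|level_set L a eps|%:R.
Proof.
move=> h0 hZ hZp hZm L0 hk hr /card_gt0P[i0 _]; set N := level_set _ _ _.
have Z0 q' : 0 < \sum_i x i `^ q' by apply: (sumr_all_gt0 i0) => i; exact: powR_gt0.
have e q' i : x i `^ q' = expR (q' * ln (x i)) by rewrite /powR gt_eqF.
pose u := expR (L * (- t - dl)).
have u0 : 0 < u by exact: expR_gt0.
have hZ' : u <= \sum_i x i `^ q by rewrite -ler_ln ?posrE// expRK.
have quarter y : y <= L * (- t - eps * h + k) -> expR y <= u / 4.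
  move=> hy; rewrite -[X in u / X](@lnK R) ?posrE// -expRB ler_expR (le_trans hy)//.
  have := ler_wpM2l L0 hk; lra.
pose hi := [pred i | - (L * (a - eps)) < ln (x i)].
pose lo := [pred i | ln (x i) < - (L * (a + eps))].
have shi : \sum_(i | hi i) x i `^ q <= u / 4.
  apply: (@le_trans _ _ (expR (L * (a - eps) * h) * \sum_i x i `^ (q + h))).
    rewrite mulr_sumr [leRHS](bigID hi)/=; apply: ler_wpDr.
      by apply: sumr_ge0 => i _; rewrite mulr_ge0 ?expR_ge0 ?powR_ge0.
    apply: ler_sum => i /= hii; rewrite !e -expRD ler_expR.
    have := ler_wpM2r (ltW h0) (ltW hii); lra.
  rewrite -[\sum_i _](@lnK R) ?posrE// -expRD; apply: quarter; lra.
have slo : \sum_(i | lo i) x i `^ q <= u / 4.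
  apply: (@le_trans _ _ (expR (- (L * (a + eps)) * h) * \sum_i x i `^ (q - h))).
    rewrite mulr_sumr [leRHS](bigID lo)/=; apply: ler_wpDr.
      by apply: sumr_ge0 => i _; rewrite mulr_ge0 ?expR_ge0 ?powR_ge0.
    apply: ler_sum => i /= hii; rewrite !e -expRD ler_expR.
    have := ler_wpM2r (ltW h0) (ltW hii); lra.
  rewrite -[\sum_i _](@lnK R) ?posrE// -expRD; apply: quarter; lra.
have sN : u / 2 <= \sum_(i in N) x i `^ q.
  have : \sum_i x i `^ q <= \sum_(i in N) x i `^ q +
      (\sum_(i | hi i) x i `^ q + \sum_(i | lo i) x i `^ q).
    rewrite [leLHS](bigID [in N])/= lerD2l.
    rewrite [leLHS](bigID hi)/=; apply: lerD.
      rewrite [leRHS](bigID [in N])/= addrC; apply: ler_wpDr.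
        by apply: sumr_ge0 => i _; exact: powR_ge0.
      rewrite le_eqVlt; apply/orP; left; apply/eqP.
      by apply: eq_bigl => i; rewrite andbC.
    rewrite [leRHS](bigID (fun i => (i \notin N) && ~~ hi i))/=.
    apply: ler_wpDr; first by apply: sumr_ge0 => i _; exact: powR_ge0.
    rewrite le_eqVlt; apply/orP; left; apply/eqP; apply: eq_bigl => i.
    apply/idP/idP => [/[dup] iNh /andP[iN hii]|/andP[]//]; rewrite iNh andbT.
    move: iN hii; rewrite inE negb_and -!ltNge => /orP[//|h1] /negP h2.
    by case: h2.
  by move: shi slo hZ'; lra.
have hN : \sum_(i in N) x i `^ q <= #|N|%:R * expR (L * (- (a * q) + `|q| * eps)).
  rewrite mulr_natl -sumr_const; apply: ler_sum => i iN; rewrite e ler_expR.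
  by have := level_setP q iN; rewrite ler_norml => /andP[]; lra.
have {sN hN} := le_trans sN hN.
rewrite -ler_pdivrMr ?expR_gt0//; apply: le_trans.
rewrite -expRN.
have -> : u / 2 * expR (- (L * (- (a * q) + `|q| * eps))) =
    2^-1 * expR (L * (a * q - t - `|q| * eps - dl)).
  by rewrite /u mulrAC mulrC -expRD; congr (_ * expR _); ring.
rewrite -[2^-1](@lnK R) ?posrE// -expRD ler_expR lnV ?posrE//.
have : ln (2 : R) <= ln 4 by rewrite ler_ln ?posrE//; lra.
by lra.
Qed.

End count.

(** * Second-order control of a function on an interval *)

Lemma taylor_lower_bound (R : realType) (f : R -> R) (Q : R) :
  twice_continuously_differentiable f -> 0 <= Q ->
  exists2 D : R, 1 <= D & forall q h, `|q| <= Q -> `|q + h| <= Q ->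
    f q + derive1 f q * h - D * h ^+ 2 <= f (q + h).
Proof.
move=> [df ddf cddf] Q0.
have NQ : - Q <= Q by lra.
have [M M0 hM] : exists2 M : R, 0 <= M &
    forall t, t \in `[- Q, Q]%R -> `|derive1 (derive1 f) t| <= M.
  have [m _ hm] : exists2 m, m \in `[- Q, Q]%R & forall t, t \in `[- Q, Q]%R ->
      `|derive1 (derive1 f) t| <= `|derive1 (derive1 f) m|.
    apply: EVT_max => //; apply: continuous_subspaceT => x.
    by apply: continuous_comp; [exact: cddf|exact: norm_continuous].
  by exists `|derive1 (derive1 f) m|.
have inQ u v w : `|u| <= Q -> `|v| <= Q -> w \in `[u, v]%R -> `|w| <= Q.
  rewrite in_itv/= !ler_norml => /andP[? ?] /andP[? ?] /andP[? ?].
  by apply/andP; split; lra.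
have drv (g : R -> R) : (forall x : R, derivable g x 1) ->
    forall x : R, is_derive x 1 g (derive1 g x).
  by move=> dg x; rewrite derive1E; exact/derivableP.
have cont (g : R -> R) : (forall x : R, derivable g x 1) ->
    forall A : set R, {within A, continuous g}.
  move=> dg A; apply: continuous_subspaceT => x.
  exact/differentiable_continuous/derivable1_diffP.
have lip u v : u <= v -> `|u| <= Q -> `|v| <= Q ->
    `|derive1 f v - derive1 f u| <= M * (v - u).
  move=> uv hu hv.
  have [w wuv ->] := MVT_segment uv (fun x _ => drv _ ddf x) (cont _ ddf _).
  have vu0 : 0 <= v - u by rewrite subr_ge0.
  have wQ : w \in `[- Q, Q]%R.
    by move: (inQ _ _ _ hu hv wuv); rewrite in_itv/= ler_norml.
  rewrite normrM [X in _ * X](ger0_norm vu0).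
  exact: ler_wpM2r vu0 _ _ (hM _ wQ).
exists (M + 1); first by rewrite lerDr.
move=> q h hq hqh.
have [h0|h0] := leP 0 h.
  have qh : q <= q + h by rewrite lerDl.
  have [w wq] := MVT_segment qh (fun x _ => drv _ df x) (cont _ df _).
  have := inQ _ _ _ hq hqh wq; move: wq; rewrite in_itv/= => /andP[w1 w2] hw.
  have := lip _ _ w1 hq hw; rewrite ler_norml => /andP[+ _] e.
  rewrite (_ : q + h - q = h) in e; last by ring.
  have w3 : M * (w - q) <= M * h by rewrite ler_wpM2l//; lra.
  by move=> l; nra.
have qh : q + h <= q by lra.
have [w wq] := MVT_segment qh (fun x _ => drv _ df x) (cont _ df _).
have := inQ _ _ _ hqh hq wq; move: wq; rewrite in_itv/= => /andP[w1 w2] hw.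
have := lip _ _ w2 hw hq; rewrite ler_norml => /andP[+ _] e.
rewrite (_ : q - (q + h) = - h) in e; last by ring.
have w3 : M * (q - w) <= M * - h by rewrite ler_wpM2l//; lra.
by move=> l; nra.
Qed.

Lemma compact_norm_bound (R : realType) (K : set R) : compact K ->
  forall q, K q -> `|q| <= sup [set `|q| | q in K].
Proof.
move=> /compact_bounded[M [Mr hM]] q Kq.
apply: ub_le_sup; last by exists q.
exists (M + 1) => _ [y Ky <-]; apply: (hM (M + 1)) => //.
by rewrite ltrDl.
Qed.

(** * Exceptional families of weights *)

Lemma almost_additiveW d (T : measurableType d) (R : realType)
    (P : probability T R) S U V (k k' A A' : R) : k <= k' -> A <= A' ->
  almost_additive P S U V k A -> almost_additive P S U V k' A'.
Proof.
move=> kk AA [mS mU mV hS hU hV hl hi]; split => //.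
- move=> n n0; move: (hS n n0); apply: filterS => t /le_trans; apply.
  by rewrite ler_wpM2l.
- by move=> n n0; move: (hU n n0); apply: filterS => t /le_trans; apply.
- by move=> n m n0 m0; move: (hV n m n0 m0); apply: filterS => t /le_trans; apply.
Qed.

Section exceptional_families.
Context (R : realType) (J : finType) (c : R) (n N : nat).
Context (grid e : nat -> R) (x : R).

(** Excluding the first alternative bounds the logarithms of the weights, so that
    the power sums vary slowly between two points of the grid. *)
Definition exceptional (g : J -> \bar R) : Prop :=
  ~ (forall w, ((c ^+ n)%:E <= g w <= 1)%E) \/
  exists2 i, (i < N)%N & x <= `|log_sum (grid i) g - e i|.

Lemma measurable_bounds d (T : measurableType d) (G : J -> T -> \bar R) :
  (forall w, measurable_fun setT (G w)) ->
  measurable [set t | forall w, ((c ^+ n)%:E <= G w t <= 1)%E].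
Proof.
move=> mG.
rewrite [X in measurable X](_ : _ = \bigcap_(w in [set: J])
   ([set t | ((c ^+ n)%:E <= G w t)%E] `&` [set t | (G w t <= 1)%E])); last first.
  apply/seteqP; split => t h w; first by move=> _; apply/andP; exact: h.
  by apply/andP; exact: (h w I).
apply: fin_bigcap_measurable; first exact: finite_finset.
by move=> w _; apply: measurableI; rewrite -[X in measurable X]setTI;
  apply: measurable_lee.
Qed.

Lemma measurable_deviation d (T : measurableType d) (G : J -> T -> \bar R) i :
  (forall w, measurable_fun setT (G w)) ->
  measurable [set t | x <= `|log_sum (grid i) (G^~ t) - e i|].
Proof.
move=> mG; apply: measurable_set_le => //.
apply: measurableT_comp => //; apply: measurable_funB => //.
exact: measurable_log_sum.
Qed.

Lemma exceptional_setE (T : Type) (G : J -> T -> \bar R) :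
  [set t | exceptional (G^~ t)] =
  ~` [set t | forall w, ((c ^+ n)%:E <= G w t <= 1)%E] `|`
  \big[setU/set0]_(i < N) [set t | x <= `|log_sum (grid i) (G^~ t) - e i|].
Proof.
rewrite -(bigcup_mkord N (fun i => [set t | x <= `|log_sum (grid i) (G^~ t) - e i|])).
apply/seteqP; split=> t [h|].
- by left.
- by move=> [i iN hi]; right; exists i.
- by left.
- by move=> [i iN hi]; right; exists i.
Qed.

Lemma measurable_exceptional d (T : measurableType d) (G : J -> T -> \bar R) :
  (forall w, measurable_fun setT (G w)) -> measurable [set t | exceptional (G^~ t)].
Proof.
move=> mG; rewrite exceptional_setE; apply: measurableU.
  by apply: measurableC; exact: measurable_bounds.
by apply: bigsetU_measurable => i _; exact: measurable_deviation.
Qed.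

Lemma exceptional_probability d (T : measurableType d) (P : probability T R)
    (G : J -> T -> \bar R) p :
  (forall w, measurable_fun setT (G w)) ->
  {ae P, forall t, forall w, ((c ^+ n)%:E <= G w t <= 1)%E} ->
  (forall i, (i < N)%N ->
    P [set t | (x <= `|log_sum (grid i) (G^~ t) - e i|)%R] <= p%:E)%E ->
  (P [set t | exceptional (G^~ t)] <= (N%:R * p)%R%:E)%E.
Proof.
move=> mG hG hp; rewrite exceptional_setE.
have mb := measurable_bounds mG.
have md i := measurable_deviation i mG.
have p0 : P (~` [set t | forall w, ((c ^+ n)%:E <= G w t <= 1)%E]) = 0%E.
  by apply/negligibleP => //; exact: measurableC.
have md' : measurable (\big[setU/set0]_(i < N)
    [set t | x <= `|log_sum (grid i) (G^~ t) - e i|]).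
  by apply: bigsetU_measurable => i _.
apply: (le_trans (measureU2 P (measurableC mb) md')).
rewrite [X in (X + _)%E]p0 add0e.
rewrite (le_trans (@Boole_inequality _ _ _ P
  (fun i => [set t | x <= `|log_sum (grid i) (G^~ t) - e i|]) N _))//.
apply: (@le_trans _ _ (\sum_(i < N) p%:E)%E).
  by apply: lee_sum => i _; exact: hp.
by rewrite sumEFin sumr_const card_ord mulr_natl.
Qed.

End exceptional_families.

(** * From the fluctuations of the partition functions to the counts *)

Lemma dist_through_means (R : realType) (a a' e e' t A X Y Z : R) :
  `|a - a'| <= A -> `|e - e'| <= A -> `|a' - e'| < X -> `|e + t| <= 2 * Y ->
  Y <= Z -> `|a + t| <= X + (2 * A + 2 * Z).
Proof.
rewrite !ler_norml ltr_norml.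
by move=> /andP[? ?] /andP[? ?] /andP[? ?] /andP[? ?] ?; apply/andP; split; lra.
Qed.

(** The choices eps^2 / (16 D) for the admissible fluctuation and eps / (2 D)
    for the shift of the exponent. The second minimizes D h^2 - eps h; the
    minimum, minus four times the first, pays for the fluctuation at the shifted
    exponent, for the fluctuation at q and for the loss of a constant factor. *)
Lemma counting_scales (R : realType) (eps D : R) : 0 < eps -> eps <= 1 -> 1 <= D ->
  [/\ 0 < eps ^+ 2 / (16 * D), eps ^+ 2 / (16 * D) + eps ^+ 2 / (16 * D) <= eps,
    0 < eps / (2 * D), eps / (2 * D) <= 1 &
    D * (eps / (2 * D)) ^+ 2 - eps * (eps / (2 * D)) =
      - 4 * (eps ^+ 2 / (16 * D))].
Proof.
move=> e0 e1 D1; have D0 : 0 < D by lra.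
have Dn : D != 0 by exact: lt0r_neq0.
split.
- by rewrite divr_gt0 ?exprn_gt0// mulr_gt0.
- have -> : eps ^+ 2 / (16 * D) + eps ^+ 2 / (16 * D) = eps * (eps / (8 * D)).
    by field.
  have h : eps / (8 * D) <= 1 by rewrite ler_pdivrMr ?mulr_gt0//; lra.
  by rewrite ler_piMr// ltW.
- by rewrite divr_gt0// mulr_gt0.
- by rewrite ler_pdivrMr ?mulr_gt0//; lra.
- by field.
Qed.

Section main.
Context (R : realType) (d : measure_display) (Omega : measurableType d).
Context (P : probability Omega R) (b : nat) (hb : (2 <= b)%N).
Context (mu : R.-pker Omega ~> symb hb) (C : R).
Context (mul mur : nat -> R.-ker Omega ~> symb hb).
Hypothesis hmu : quasi_Bernoulli_independent P mu C mul mur.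
Context (tau : R -> R).
Hypothesis htau : is_tau P mu tau.
Context (c : R).
Hypotheses (c0 : 0 < c) (c1 : c <= 1).
Hypothesis mu_lower : {ae P, forall om, forall n (w : n.-tuple (letter hb)),
    ((c ^+ n)%:E <= mu om (cylinder w))%E}.

Local Notation letter := (letter hb).
Local Notation B := (ln b%:R : R).
Local Notation e q n := (mean P (mu_sum mu q n)).
Local Notation K0 := `|ln C|.

Let B0 : 0 < B.
Proof. by rewrite ln_gt0// ltr1n. Qed.

Let Hq q := quasi_Bernoulli_almost_additive hmu c0 mu_lower q.

(** The strong law holds for each q almost surely, and tau(q) is almost surely
    the lower limit of the same sequence; two almost sure events meet. *)
Lemma mean_tau q n : (0 < n)%N ->
  `|e q n + n%:R * (B * tau q)| <= 2 * (`|q| * K0).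
Proof.
move=> n0; have [l hl] := mean_drift (Hq q).
suff -> : tau q = - l / B.
  have := hl n n0; rewrite (_ : B * (- l / B) = - l) ?mulrN//.
  by field; exact: lt0r_neq0.
have slln := almost_additive_slln (Hq q) hl.
have : {ae P, forall om, (tau q = - l / B)}.
  move: slln htau; apply: filterS2 => om hs /(_ q) ht.
  apply: EFin_inj; rewrite -ht /tau_measure.
  apply: (cvg_limn_einf_sup _).1; apply: cvg_EFin; first exact: nearW.
  have -> : fine \o (fun n => (tau_n (mu om) q n)%:E) =
      (fun n => (- (mu_sum mu q n om / n%:R)) / B).
    apply/funext => k; rewrite /= /tau_n /mu_sum /log_sum; ring.
  by apply: cvgM; [exact: cvgN|exact: cvg_cst].
case=> N [mN N0 sN]; apply: contrapT => h.
have : (P setT <= P N)%E by apply: le_measure; rewrite ?inE// => om _; apply: sN.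
by rewrite N0 probability_setT lee_fin ler10.
Qed.


Lemma mean_mu_lipschitz q q' n : (0 < n)%N ->
  `|e q n - e q' n| <= `|q - q'| * (n%:R * - ln c).
Proof.
move=> n0; apply: mean_dist; [exact: (aa_bS (Hq q))|exact: (aa_bS (Hq q'))|].
move: (mu_bounds c0 mu_lower); apply: filterS => om h.
apply: (dist_log_sum_exponent (const_tuple hb n)).
  by move=> w; have [] := h n w.
by move=> w; have [] := h n w.
Qed.

Context (Q : nat) (g : R).
Hypothesis g0 : 0 < g.

Definition grid n i : R := - Q%:R + i%:R / n%:R.

Definition exceptional_weights n (y : n.-tuple letter -> \bar R) :=
  exceptional c n (2 * Q * n).+1 (grid n) (fun i => e (grid n i) n)
    (g * n%:R `^ (3 / 4)) y.

Lemma grid_norm n i : (0 < n)%N -> (i < (2 * Q * n).+1)%N -> `|grid n i| <= Q%:R.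
Proof.
move=> n0 iN; have nR : 0 < n%:R :> R by rewrite ltr0n.
have i0 : 0 <= i%:R / n%:R :> R by rewrite divr_ge0.
have i1 : i%:R / n%:R <= 2 * Q%:R :> R.
  by rewrite ler_pdivrMr// -!natrM ler_nat.
by rewrite /grid ler_norml; apply/andP; split; lra.
Qed.

Lemma grid_near n q : (0 < n)%N -> `|q| <= Q%:R ->
  exists2 i, (i < (2 * Q * n).+1)%N & `|q - grid n i| <= n%:R^-1.
Proof.
move=> n0; rewrite ler_norml => /andP[q1 q2].
have nR : 0 < n%:R :> R by rewrite ltr0n.
have x0 : 0 <= (q + Q%:R) * n%:R by rewrite mulr_ge0//; lra.
have /andP[i1 i2] := truncn_itv x0; set i := Num.truncn _ in i1 i2.
exists i.
  rewrite ltnS -(ler_nat R) (le_trans i1)// !natrM ler_wpM2r//; lra.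
have -> : q - grid n i = ((q + Q%:R) * n%:R - i%:R) / n%:R.
  by rewrite /grid; field; exact: lt0r_neq0.
rewrite normrM normfV (gtr0_norm nR) -[leRHS]mul1r ler_wpM2r ?invr_ge0//.
by move: i2; rewrite -natr1 ler_norml => i2; apply/andP; split; lra.
Qed.

(** Union bound over a grid of O(n) points; the polynomial factor is absorbed
    by stretched_exp_decay. *)
Lemma exceptional_mu_probability : exists2 M : R, 0 <= M & forall n, (0 < n)%N ->
  (P [set om | exceptional_weights (fun w : n.-tuple letter => mu om (cylinder w))]
    <= (M * expR (- 2 * ln n.+1%:R ^+ 2) / (n%:R * n.+1%:R))%R%:E)%E.
Proof.
have [M M0 hM] := stretched_exp_decay g0.
pose kQ := Q%:R * K0; pose AQ := B + Q%:R * - ln c.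
have lc0 : 0 <= - ln c by rewrite oppr_ge0 ln_le0.
have cst0 : 0 <= 2 * cmgf_cst kQ AQ by rewrite mulr_ge0// expR_ge0.
exists ((2 * Q + 1)%:R * (2 * cmgf_cst kQ AQ) * M).
  by rewrite mulr_ge0// mulr_ge0.
move=> n n0.
have hbounds : {ae P, forall t, forall w : n.-tuple letter,
    ((c ^+ n)%:E <= mu t (cylinder w) <= 1)%E}.
  by move: mu_lower; apply: filterS => om h w; rewrite h mu_cylinder_le1.
have hp i : (i < (2 * Q * n).+1)%N ->
    (P [set om | (g * n%:R `^ (3 / 4) <= `|mu_sum mu (grid n i) n om -
       e (grid n i) n|)%R] <=
     (2 * cmgf_cst kQ AQ * expR (- (g * n%:R `^ 12^-1)))%R%:E)%E.
  move=> iN; have gQ := grid_norm n0 iN.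
  apply: deviation_stretched n0 g0.
  apply: almost_additiveW (Hq (grid n i)).
    by rewrite /kQ ler_wpM2r.
  by rewrite lerD2l ler_wpM2r.
have mG (w : n.-tuple letter) : measurable_fun setT (fun om => mu om (cylinder w)).
  exact: (measurable_kernel_cylinder mu).
apply: (le_trans (@exceptional_probability _ _ c n _ _ _ _ _ _ P
  (fun (w : n.-tuple letter) om => mu om (cylinder w)) _ mG hbounds hp)).
rewrite lee_fin.
apply: (@le_trans _ _ ((2 * Q + 1)%:R * (2 * cmgf_cst kQ AQ) *
   (n%:R * expR (- (g * n%:R `^ 12^-1))))).
  rewrite [leRHS](_ : _ = ((2 * Q + 1) * n)%:R *
    (2 * cmgf_cst kQ AQ * expR (- (g * n%:R `^ 12^-1)))); last by rewrite natrM; ring.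
  by rewrite ler_wpM2r ?mulr_ge0 ?expR_ge0// ler_nat; lia.
rewrite -!mulrA ler_wpM2l// ler_wpM2l// ler_wpM2l ?expR_ge0//.
by rewrite mulrA hM.
Qed.

Lemma exceptional_mur_probability j n : (0 < j)%N -> (0 < n)%N ->
  P [set om | exceptional_weights
    (fun w : n.-tuple letter => mur j om (cylinder w))] =
  P [set om | exceptional_weights
    (fun w : n.-tuple letter => mu om (cylinder w))].
Proof.
move=> j0 n0.
apply: (qBi_law hmu j0 (A := [set y : word hb -> \bar R |
  exceptional_weights (fun w : n.-tuple letter => y (tuple_word n0 w))])).
apply: (@measurable_exceptional _ _ c n _ _ _ _ _ (g_sigma_algebraType
  (\bigcup_i preimage_set_system setT
     (fun f : word hb -> \bar R => f i) (@measurable _ (\bar R))))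
  (fun (w : n.-tuple letter) y => y (tuple_word n0 w))) => w.
exact: (@measurable_sigma_of R _ _ (fun w (f : word hb -> \bar R) => f w)).
Qed.

(** Move from q to the nearest grid point, from the power sum there to its
    mean, back to the mean at q, and from it to the linear function of n of
    slope - tau(q) ln b. The first and third steps cost - ln c each because the mesh
    1/n compensates the Lipschitz constant - n ln c. *)
Lemma unexceptional_log_sum n (y : n.-tuple letter -> \bar R) q : (0 < n)%N ->
  ~ exceptional_weights y -> `|q| <= Q%:R ->
  `|log_sum q y + n%:R * (B * tau q)| <=
    g * n%:R `^ (3 / 4) + (2 * - ln c + 2 * (Q%:R * K0)).
Proof.
move=> n0 /not_orP[/contrapT yb hdev] qQ.
have nR : 0 < n%:R :> R by rewrite ltr0n.
have lc0 : 0 <= - ln c by rewrite oppr_ge0 ln_le0.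
have [i iN qi] := grid_near n0 qQ.
have h1 : `|log_sum q y - log_sum (grid n i) y| <= - ln c.
  apply: (@le_trans _ _ (`|q - grid n i| * (n%:R * - ln c))).
    by apply: (dist_log_sum_exponent (const_tuple hb n)) => w;
      have [] := fine_bounds c0 (yb w).
  by rewrite mulrA ler_piMl// -ler_pdivlMr// div1r.
have h2 : `|e q n - e (grid n i) n| <= - ln c.
  rewrite (le_trans (mean_mu_lipschitz _ _ n0))//.
  by rewrite mulrA ler_piMl// -ler_pdivlMr// div1r.
have h3 : `|log_sum (grid n i) y - e (grid n i) n| < g * n%:R `^ (3 / 4).
  by rewrite ltNge; apply/negP => h; apply: hdev; exists i.
have h4 := mean_tau q n0.
have h5 : `|q| * K0 <= Q%:R * K0 by rewrite ler_wpM2r.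
exact: dist_through_means h1 h2 h3 h4 h5.
Qed.

Lemma powR_alphabet y : b%:R `^ y = expR (y * B) :> R.
Proof. by rewrite /powR pnatr_eq0 gtn_eqF// ltnW. Qed.

Lemma counting_level_set n (m : set (symb hb) -> \bar R) a eps :
  (forall w : n.-tuple letter, ((c ^+ n)%:E <= m (cylinder w) <= 1)%E) ->
  counting_function n m a eps =
  #|level_set (fun w : n.-tuple letter => fine (m (cylinder w))) (n%:R * B) a eps|.
Proof.
move=> hm; rewrite /counting_function /level_set cardsE; apply: eq_card => w.
have [ew w0 _] := fine_bounds c0 (hm w).
rewrite !inE/= -ew !lee_fin !powR_alphabet -[X in (_ <= X) && _](@lnK R) ?posrE//.
rewrite -[X in _ && (X <= _)](@lnK R) ?posrE// !ler_expR.
by congr (_ && _); congr (_ <= _); ring.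
Qed.

(** The estimates of the previous part at L = n ln b with the scales of
    counting_scales. The hypothesis on ln 4 absorbs the constant lost in the
    lower bound, and beta has to exceed |q| by 1 to cover |q| eps + 2 eps^2 / (16 D). *)
Lemma counting_bounds n (m : set (symb hb) -> \bar R) (q a eps D beta : R) :
  (0 < n)%N ->
  (forall w : n.-tuple letter, ((c ^+ n)%:E <= m (cylinder w) <= 1)%E) ->
  1 <= D -> 0 < eps -> eps <= 1 -> `|q| + 1 <= Q%:R -> `|q| + 1 <= beta ->
  (forall h, `|q + h| <= Q%:R -> tau q + a * h - D * h ^+ 2 <= tau (q + h)) ->
  (forall q', `|q'| <= Q%:R ->
    `|log_sum q' (fun w : n.-tuple letter => m (cylinder w)) +
      n%:R * (B * tau q')| <= n%:R * B * (eps ^+ 2 / (16 * D))) ->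
  ln 4 <= n%:R * B * (eps ^+ 2 / (16 * D)) ->
  b%:R `^ (n%:R * (a * q - tau q - beta * eps))
    <= (counting_function n m a eps)%:R
    <= b%:R `^ (n%:R * (a * q - tau q + beta * eps)).
Proof.
move=> n0 hm D1 e0 e1 qQ qb taylor hlog h4.
rewrite (counting_level_set _ _ hm) !powR_alphabet.
set x := fun w => _; set L := n%:R * B.
have x0 w : 0 < x w by have [] := fine_bounds c0 (hm w).
have L0 : 0 < L by rewrite mulr_gt0// ltr0n.
set dl := eps ^+ 2 / (16 * D) in hlog h4.
have D0 : 0 < D by lra.
have [dl0 dle h0 h1 eh] := counting_scales e0 e1 D1.
rewrite -/dl in dl0 dle eh.
have hL q' : `|q'| <= Q%:R -> - (L * tau q') - L * dl <= ln (\sum_w x w `^ q') /\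
    ln (\sum_w x w `^ q') <= - (L * tau q') + L * dl.
  by move=> /hlog; rewrite /log_sum mulrA -/L ler_norml => /andP[]; lra.
have qe : `|q| * eps + eps <= beta * eps.
  by rewrite -[X in _ + X]mul1r -mulrDl ler_wpM2r// ltW.
have q1 : `|q| <= Q%:R by lra.
have [lq uq] := hL q q1.
apply/andP; split; last first.
  apply: le_trans (card_level_set_le x0 (L := L) (t := - tau q + dl) _ _ _) _.
    by lra.
  rewrite ler_expR (_ : n%:R * _ * B = L * (a * q - tau q + beta * eps));
    last by rewrite /L; ring.
  by rewrite ler_pM2l//; lra.
set h := eps / (2 * D) in h0 h1 eh.
have hQ s : `|s| = h -> `|q + s| <= Q%:R.
  by move=> sh; rewrite (le_trans (ler_normD _ _))// sh; lra.
have hp : `|h| = h by rewrite gtr0_norm.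
have hn : `|- h| = h by rewrite normrN.
have [_ up] := hL _ (hQ _ hp); have [_ um] := hL _ (hQ _ hn).
have tp := ler_wpM2l (ltW L0) (taylor _ (hQ _ hp)).
have tm := ler_wpM2l (ltW L0) (taylor _ (hQ _ hn)).
apply: le_trans (card_level_set_ge (L := L) (a := a) (eps := eps) (q := q)
  (t := tau q) (h := h) (k := D * h ^+ 2 + dl) (dl := dl) (r := dl)
  x0 h0 _ _ _ _ _ _ _).
- rewrite ler_expR (_ : n%:R * _ * B = L * (a * q - tau q - beta * eps));
    last by rewrite /L; ring.
  by rewrite ler_pM2l//; lra.
- by lra.
- by lra.
- by rewrite sqrrN in tm; lra.
- exact: ltW.
- by lra.
- by [].
- by apply/card_gt0P; exists (const_tuple hb n).
Qed.

Context (alpha : R).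
Hypothesis alpha1 : 1 < alpha.

Definition first_length j : nat := Num.truncn (expR (Num.sqrt (alpha * ln j%:R)) : R).

Lemma first_length_gt0 j : (0 < first_length j)%N.
Proof. by rewrite truncn_gt0 -expR0 ler_expR sqrtr_ge0. Qed.

(** This is the reason for the threshold exp(sqrt(alpha ln j)): it turns
    exp(- 2 ln(n+1)^2) into j^-2. *)
Lemma ln_first_length j : (0 < j)%N -> ln j%:R <= ln (first_length j).+1%:R ^+ 2 :> R.
Proof.
move=> j0; have lj : 0 <= ln j%:R :> R by rewrite ln_ge0// ler1n.
apply: (@le_trans _ _ (alpha * ln j%:R)); first by rewrite ler_peMl// ltW.
have aj : 0 <= alpha * ln j%:R by rewrite mulr_ge0// (le_trans _ (ltW alpha1)).
rewrite -(sqr_sqrtr aj) lerXn2r ?nnegrE ?sqrtr_ge0 ?ln_ge0 ?ler1n//.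
rewrite -[leLHS]expRK ler_ln ?posrE ?expR_gt0 ?ltr0n//.
exact/ltW/truncnS_gt.
Qed.

(** The tail over n >= first_length j of the probabilities of
    exceptional_mu_probability telescopes to O(j^-2). *)
Lemma mur_eventually_unexceptional : {ae P, forall om, \forall j \near \oo, forall n,
  (first_length j <= n)%N ->
  ~ exceptional_weights (fun w : n.-tuple letter => mur j om (cylinder w))}.
Proof.
have [M M0 hM] := exceptional_mu_probability.
pose G j n := [set om | exceptional_weights
  (fun w : n.-tuple letter => mur j om (cylinder w))].
pose F j := \bigcup_(n in [set n | (first_length j <= n)%N]) G j n.
have mG j n : measurable (G j n).
  apply: (@measurable_exceptional _ _ c n _ _ _ _ _ Omega
    (fun (w : n.-tuple letter) om => mur j om (cylinder w))) => w.
  exact: measurable_kernel_cylinder.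
have mF j : measurable (F j) by apply: bigcup_measurable => n _; exact: mG.
have PF j : (0 < j)%N -> (P (F j) <= (2 * M / (j%:R * j.+1%:R))%:E)%E.
  move=> j0; have s0 := first_length_gt0 j.
  have := @measure_sigma_subadditive_tail _ _ _ P (F j) (G j) (first_length j)
    (mG j) (mF j).
  move=> /(_ _)/le_trans; apply; first by rewrite setC_I.
  pose x := M * expR (- 2 * ln (first_length j).+1%:R ^+ 2).
  have x0 : 0 <= x by rewrite mulr_ge0 ?expR_ge0.
  apply: (@le_trans _ _ (\sum_(first_length j <= k <oo) (x / (k%:R * k.+1%:R))%:E)%E).
    apply: lee_lim.
    - by apply: is_cvg_nneseries => k _ _.
    - by apply: is_cvg_nneseries => k _ _; rewrite lee_fin divr_ge0// mulr_ge0.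
    apply: nearW => m; rewrite big_nat [leRHS]big_nat.
    apply: lee_sum => k /andP[sk _].
    have k0 : (0 < k)%N by rewrite (leq_trans s0).
    have := hM k k0; rewrite -(exceptional_mur_probability j0 k0) => hk.
    apply: (le_trans hk); rewrite lee_fin.
    rewrite ler_wpM2r ?invr_ge0 ?mulr_ge0// ler_wpM2l// ler_expR !mulNr lerN2.
    rewrite ler_pM2l// lerXn2r ?nnegrE ?ln_ge0 ?ler1n//.
    by rewrite ler_ln ?posrE ?ltr0n// ler_nat.
  apply: (le_trans (telescope_sum_le s0 x0)).
  rewrite lee_fin /x.
  have jR : 1 <= j%:R :> R by rewrite ler1n.
  have -> : 2 * M / (j%:R * j.+1%:R) = M * (2 / (j%:R * j.+1%:R)).
    by rewrite mulrCA mulrA.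
  rewrite ler_wpM2l//.
  apply: (@le_trans _ _ (expR (- (2 * ln j%:R)))).
    by rewrite ler_expR mulNr lerN2 ler_pM2l//; exact: ln_first_length.
  rewrite expRN mulrC expRM_natr lnK ?posrE ?ltr0n//.
  rewrite ler_pdivlMr ?mulr_gt0 ?ltr0n// mulrC ler_pdivrMr ?exprn_gt0 ?ltr0n//.
  by rewrite -natr1; nra.
have M20 : 0 <= 2 * M by rewrite mulr_ge0.
have := borel_cantelli M20 (fun j _ => mF j) PF.
apply: filterS => om; apply: filterS => j hF n jn hbounds.
by apply: hF; exists n.
Qed.
End main.

Theorem theorem3 (R : realType) (d : measure_display) (Omega : measurableType d)
    (P : probability Omega R) (b : nat) (hb : (2 <= b)%N)
    (mu : R.-pker Omega ~> symb hb)
    (C : R) (mul mur : nat -> R.-ker Omega ~> symb hb)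
    (hmu : quasi_Bernoulli_independent P mu C mul mur)
    (tau : R -> R) (htau : is_tau P mu tau)
    (htau2 : twice_continuously_differentiable tau)
    (eps : nat -> R)
    (eps_gt0 : forall n, (0 < n)%N -> 0 < eps n)
    (eps_cvg0 : eps @ \oo --> 0)
    (eps_series : forall M a : R, 0 < M -> 0 < a ->
      cvgn (series (fun k : nat => let n := k.+1 in
        b%:R `^ (M * n%:R `^ (3 / 4) * ln n%:R)
        * b%:R `^ (- (n%:R * a * eps n ^+ 2)) : R)))
    (eta : R) (eta_gt0 : 0 < eta)
    (eps_ge : forall n, (0 < n)%N ->
      n%:R `^ (- (1 / 8)) * ln n%:R `^ (1 / 2 + eta) <= eps n)
    (K : set R) (K_nonempty : K !=set0) (K_compact : compact K)
    (K_interval : is_interval K)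
    (K_sub_J : K `<=` [set q | 0 < derive1 tau q * q - tau q])
    (alpha : R) (alpha_gt1 : 1 < alpha) :
  let beta := 1 + sup [set `|q| | q in K] in
  {ae P, forall om, \forall j \near \oo, forall (q : R) (n : nat), K q ->
    (Num.truncn (expR (Num.sqrt (alpha * ln j%:R))) <= n)%N ->
    b%:R `^ (n%:R * (derive1 tau q * q - tau q - beta * eps n))
      <= (counting_function n (mur j om) (derive1 tau q) (eps n))%:R
      <= b%:R `^ (n%:R * (derive1 tau q * q - tau q + beta * eps n))}.
Proof.
move=> beta.
have [c [c0 c1 mu_lower]] := mu_lower_bound hmu.
have B0 : 0 < ln b%:R :> R by rewrite ln_gt0// ltr1n.
have Kbeta q : K q -> `|q| + 1 <= beta.
  by move=> Kq; rewrite /beta addrC lerD2l; exact: compact_norm_bound.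
have [q0 Kq0] := K_nonempty.
have beta0 : 0 <= beta by have := Kbeta _ Kq0; have := normr_ge0 q0; lra.
pose Q := (Num.truncn beta).+1.
have bQ : beta <= Q%:R by exact/ltW/truncnS_gt.
have [D D1 taylor] := taylor_lower_bound htau2 (ler0n R Q).
have D0 : 0 < D by lra.
(* With this g the deviation g n^(3/4) uses a quarter of the admissible
   fluctuation n ln b eps^2 / (16 D), because eps^2 >= n^(-1/4); for large n the
   bounded errors collected in Z fit in the rest. *)
pose g := ln b%:R / (64 * D).
have g0 : 0 < g by rewrite divr_gt0// mulr_gt0.
pose E := 2 * - ln c + 2 * (Q%:R * `|ln C|).
pose Z := `|E| + ln 4.
have ln4 : 0 <= ln 4 :> R by rewrite ln_ge0// ler1n.
have Z0 : 0 <= Z by rewrite addr_ge0.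
have n_large : \forall n \near \oo,
    [/\ expR 1 <= n%:R :> R, eps n <= 1 & Z <= g * n%:R `^ (3 / 4)].
  have Zg0 : 0 <= Z / g by rewrite divr_ge0// ltW.
  near=> n; split.
  - near: n; exists (Num.truncn (expR 1 : R)).+1 => // n /= hn.
    by rewrite (le_trans (ltW (truncnS_gt _)))// ler_nat.
  - by near: n; exact: (cvgr_le _ eps_cvg0 _ ltr01).
  - rewrite mulrC -ler_pdivrMr//.
    have -> : Z / g = ((Z / g) `^ (4 / 3)) `^ (3 / 4).
      by rewrite -powRrM (_ : 4 / 3 * (3 / 4) = 1) ?powRr1//; field.
    rewrite ge0_ler_powR ?nnegrE ?powR_ge0//.
    near: n; exists (Num.truncn ((Z / g) `^ (4 / 3))).+1 => // n /= hn.
    by rewrite (le_trans (ltW (truncnS_gt _)))// ler_nat.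
have first_length_large N : \forall j \near \oo, (N <= first_length alpha j)%N.
  case: N => [|N]; first exact: nearW.
  near=> j.
  have hj : expR (ln N.+1%:R ^+ 2) <= j%:R :> R.
    near: j; exists (Num.truncn (expR (ln N.+1%:R ^+ 2) : R)).+1 => // j /= hj.
    by rewrite (le_trans (ltW (truncnS_gt _)))// ler_nat.
  have jR : 0 < j%:R :> R by rewrite (lt_le_trans (expR_gt0 _) hj).
  have lj : ln N.+1%:R ^+ 2 <= ln j%:R :> R by rewrite -ler_expR lnK ?posrE.
  have lj0 : 0 <= ln j%:R :> R by rewrite (le_trans _ lj)// sqr_ge0.
  rewrite /first_length truncn_ge_nat ?expR_ge0// -[leLHS](@lnK R) ?posrE ?ltr0n//.
  rewrite ler_expR -[leLHS]ger0_norm ?ln_ge0 ?ler1n// -sqrtr_sqr ler_sqrt.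
    by rewrite (le_trans lj)// ler_peMl// ltW.
  by rewrite mulr_ge0// ltW// (lt_trans _ alpha_gt1).
have [N _ hN] := n_large.
move: (mur_eventually_unexceptional hmu c0 c1 mu_lower Q g0 alpha_gt1).
apply: filterS => om good.
near=> j => q n Kq jn.
have Nn : (N <= n)%N.
  by apply: leq_trans jn; near: j; exact: first_length_large.
have [n3 en1 Zn] := hN n Nn.
have nR : 0 < n%:R :> R by rewrite (lt_le_trans (expR_gt0 1)).
have n0 : (0 < n)%N by rewrite -(ltr0n R).
have hgood : ~ exceptional_weights P mu c Q g
    (fun w : n.-tuple (letter hb) => mur j om (cylinder w)).
  by move: n jn {Nn n3 en1 Zn n0 nR}; near: j.
have hb1 : forall w : n.-tuple (letter hb),
    ((c ^+ n)%:E <= mur j om (cylinder w) <= 1)%E.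
  by move/not_orP : hgood => [/contrapT].
have eps2 : n%:R `^ (3 / 4) <= n%:R * eps n ^+ 2.
  have ln1 : 1 <= ln n%:R :> R by rewrite -ler_expR lnK ?posrE.
  have e8 : n%:R `^ (- (1 / 8)) <= eps n.
    apply: le_trans (eps_ge _ n0); rewrite ler_peMr ?powR_ge0//.
    by rewrite -[leLHS](powRr0 (ln n%:R)) ler_powR// addr_ge0// ltW.
  apply: (@le_trans _ _ (n%:R * (n%:R `^ (- (1 / 8))) ^+ 2)).
    have n1 : n%:R = n%:R `^ 1 :> R by rewrite powRr1// ltW.
    rewrite -powR_mulrn ?powR_ge0// -powRrM [X in _ <= X * _]n1.
    rewrite -powRD; last by rewrite (gt_eqF nR) implybT.
    by rewrite (_ : 3 / 4 = 1 + - (1 / 8) * 2%:R) //; field.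
  apply: ler_wpM2l; first exact: ltW.
  by rewrite lerXn2r ?nnegrE ?powR_ge0//; exact/ltW/eps_gt0.
have scale : 4 * (g * n%:R `^ (3 / 4)) <= n%:R * ln b%:R * (eps n ^+ 2 / (16 * D)).
  have -> : 4 * (g * n%:R `^ (3 / 4)) = ln b%:R / (16 * D) * n%:R `^ (3 / 4).
    by rewrite /g; field; exact: lt0r_neq0.
  have -> : n%:R * ln b%:R * (eps n ^+ 2 / (16 * D)) =
      ln b%:R / (16 * D) * (n%:R * eps n ^+ 2) by field; exact: lt0r_neq0.
  by rewrite ler_wpM2l// divr_ge0 ?mulr_ge0// ltW.
have zE : E <= Z /\ ln 4 <= Z.
  by rewrite /Z; split; [rewrite ler_wpDr// ler_norm|rewrite lerDr].
have gn0 : 0 <= g * n%:R `^ (3 / 4) by rewrite mulr_ge0 ?powR_ge0// ltW.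
apply: (@counting_bounds R b hb tau c c0 Q n _ q (derive1 tau q)
  (eps n) D beta) => //.
- exact: eps_gt0.
- by rewrite (le_trans (Kbeta q Kq)).
- exact: Kbeta.
- move=> h hq; apply: taylor => //.
  by have := Kbeta q Kq; lra.
- move=> q' hq'.
  apply: (le_trans (unexceptional_log_sum hmu htau c0 c1 mu_lower n0 hgood hq')).
  rewrite -/E; lra.
- by lra.
Unshelve. all: by end_near. Qed.
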